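(* Let $n\ge1$ and $1\le p<q<\infty$. If $f\in L^1_{\mathrm{loc}}(\mathbb{R}^n)$ and $f\ge0$ a.e., then $\|f\|_{SR_{p,q}(\mathbb{R}^n)}\approx\|f\|_{H_q^{-n(\frac1p-\frac1q)}(\mathbb{R}^n)}$, with constants independent of $f$. In general, $SR_{p,q}(\mathbb{R}^n)\hookrightarrow H_q^{-n(\frac1p-\frac1q)}(\mathbb{R}^n)$. In particular, for $n\ge2$, $p=\frac{2n}{n+2}$ and $q=2$: $\|f\|_{SR_{\frac{2n}{n+2},2}(\mathbb{R}^n)}\approx\|f\|_{H^{-1}(\mathbb{R}^n)}$ if $f\ge0$, and consequently $SR_{\frac{2n}{n+2},2}(\mathbb{R}^n)\hookrightarrow H^{-1}(\mathbb{R}^n)$.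
   Context: $\mathcal{D}(\mathbb{R}^n)=\{2^{-k}(m+[0,1)^n):k\in\mathbb{Z},m\in\mathbb{Z}^n\}$. A countable family $(Q_i)_{i\in I}\subset\mathcal{D}(\mathbb{R}^n)$ is sparse if there exist pairwise disjoint measurable sets $E_{Q_i}\subseteq Q_i$ with $|E_{Q_i}|\ge\frac12|Q_i|$; $S(\mathbb{R}^n)$ is the collection of all sparse families. With $p'$ the dual exponent ($\frac1p+\frac1{p'}=1$), $SR_{p,q}(\mathbb{R}^n)$ is the set of $f\in L^1_{\mathrm{loc}}(\mathbb{R}^n)$ with $\|f\|_{SR_{p,q}(\mathbb{R}^n)}=\sup_{(Q_i)\in S(\mathbb{R}^n)}\big\{\sum_{i}\big(|Q_i|^{-1/p'}\int_{Q_i}|f|\big)^q\big\}^{1/q}<\infty$. For $0<\lambda<n$, $I_\lambda f(x)=\int_{\mathbb{R}^n}f(y)|x-y|^{\lambda-n}dy$ and $H_q^{-\lambda}(\mathbb{R}^n)=\{f\in L^1_{\mathrm{loc}}:\|f\|_{H_q^{-\lambda}}=\|I_\lambda f\|_{L^q(\mathbb{R}^n)}<\infty\}$; $H^{-1}=H_2^{-1}$. *)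

(* Defs.v *)
From HB Require Import structures.
From mathcomp Require Import all_boot all_order all_algebra.
From mathcomp Require Import all_classical all_reals all_analysis.
Set Implicit Arguments. Unset Strict Implicit. Unset Printing Implicit Defensive.
Import Order.TTheory GRing.Theory Num.Theory.
Import numFieldNormedType.Exports.
Local Open Scope classical_set_scope.
Local Open Scope ring_scope.

(* n-dimensional Lebesgue measure on R^n = 'rV[R]_n, built as the      *)
(* Caratheodory restriction of the Lebesgue outer measure              *)
(*   lambda^*(A) = inf { sum_k vol(B_k) | A ⊆ ⋃_k B_k, B_k boxes }.    *)
(* Technically: on a copy of 'rV[R]_n where every set is "measurable", *)
(* we extend the box-volume function vol_box (vol of a half-open box   *)
(* prod_i [a_i,b_i), +oo on non-boxes) with mu_ext.                    *)

Definition Rall (R : realType) (n : nat) : Type := 'rV[R]_n.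
HB.instance Definition _ R n := Pointed.on (Rall R n).
HB.instance Definition _ R n := @isMeasurable.Build default_measure_display
  (Rall R n) discrete_measurable discrete_measurable0
  discrete_measurableC discrete_measurableU.

Definition box (R : realType) (n : nat) (a b : 'rV[R]_n) : set 'rV[R]_n :=
  [set x | forall i : 'I_n, a ord0 i <= x ord0 i < b ord0 i].

Definition vol_box (R : realType) (n : nat) (X : set (Rall R n)) : \bar R :=
  if `[< X = set0 >] then 0%E else
  ereal_inf [set (\prod_(i < n) (ab.2 ord0 i - ab.1 ord0 i))%:E
            | ab in [set ab : 'rV[R]_n * 'rV[R]_n |
                     (forall i, ab.1 ord0 i <= ab.2 ord0 i) /\
                     X = box ab.1 ab.2]].

Lemma vol_box_ge0 (R : realType) (n : nat) (X : set (Rall R n)) :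
  (0 <= vol_box X)%E.
Proof.
rewrite /vol_box; case: ifP => // _.
apply: le_ereal_inf_tmp => _ [[a b] /= [hab _] <-].
rewrite lee_fin; apply: prodr_ge0 => i _; rewrite subr_ge0; exact: hab.
Qed.

Lemma vol_box0 (R : realType) (n : nat) : vol_box (set0 : set (Rall R n)) = 0%E.
Proof. by rewrite /vol_box asboolT. Qed.

Definition leb_outer (R : realType) (n : nat) : set (Rall R n) -> \bar R :=
  mu_ext (@vol_box R n).

HB.instance Definition _ (R : realType) (n : nat) :=
  isOuterMeasure.Build R (Rall R n) (@leb_outer R n)
    (mu_ext0 (@vol_box0 R n) (@vol_box_ge0 R n))
    (mu_ext_ge0 (@vol_box_ge0 R n))
    (le_mu_ext (@vol_box R n))
    (mu_ext_sigma_subadditive (@vol_box_ge0 R n)).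

Definition Leb (R : realType) (n : nat) := caratheodory_type (@leb_outer R n).

Definition lebn_fun (R : realType) (n : nat) : set (Leb R n) -> \bar R :=
  @leb_outer R n.

HB.instance Definition _ (R : realType) (n : nat) :=
  isMeasure.Build _ (Leb R n) R (@lebn_fun R n)
    (@caratheodory_measure0 R (Rall R n) (@leb_outer R n))
    (@caratheodory_measure_ge0 R (Rall R n) (@leb_outer R n))
    (@caratheodory_measure_sigma_additive R (Rall R n) (@leb_outer R n)).

Definition lebn (R : realType) (n : nat) : {measure set (Leb R n) -> \bar R} :=
  @lebn_fun R n.

(* Dyadic cubes  2^{-k}(m + [0,1)^n),  coded by (k, m) in Z x Z^n      *)
Definition dcode (n : nat) : Type := (int * 'rV[int]_n)%type.

Definition dcube (R : realType) (n : nat) (c : dcode n) : set (Leb R n) :=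
  [set x : 'rV[R]_n | forall i : 'I_n,
     (c.2 ord0 i)%:~R * (2%:R ^ (- c.1)) <= x ord0 i /\
     x ord0 i < ((c.2 ord0 i)%:~R + 1) * (2%:R ^ (- c.1))].

Arguments dcube R {n} c.

Definition sparse (R : realType) (n : nat) (S : set (dcode n)) : Prop :=
  countable S /\
  exists E : dcode n -> set (Leb R n),
    (forall c, S c ->
       measurable (E c) /\ E c `<=` dcube R c /\
       ((2%:R^-1)%:E * lebn R n (dcube R c) <= lebn R n (E c))%E) /\
    (forall c c', S c -> S c' -> c <> c' -> E c `&` E c' = set0).

Arguments sparse R {n} S.

(* ||f||_{SR_{p,q}} ; the exponent -1/p' is written -(1 - 1/p)         *)
Definition SR_norm (R : realType) (n : nat) (p q : R) (f : Leb R n -> R)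
  : \bar R :=
  ereal_sup [set (\esum_(c in S)
                   (((fine (lebn R n (dcube R c))) `^ (- (1 - p^-1)))%:E *
                    \int[lebn R n]_(x in dcube R c) `|f x|%:E) `^ q) `^ q^-1
            | S in [set S | sparse R S]]%E.

Definition edist (R : realType) (n : nat) (x y : 'rV[R]_n) : R :=
  Num.sqrt (\sum_(i < n) (x ord0 i - y ord0 i) ^+ 2).

Definition riesz_integrand (R : realType) (n : nat) (lam : R) (f : Leb R n -> R)
  (x : Leb R n) : Leb R n -> \bar R :=
  fun y => (f y * (edist x y) `^ (lam - n%:R))%:E.

Definition riesz (R : realType) (n : nat) (lam : R) (f : Leb R n -> R)
  (x : Leb R n) : \bar R :=
  (\int[lebn R n]_y riesz_integrand lam f x y)%E.

(* ||f||_{H_q^{-lambda}} = ||I_lambda f||_{L^q} *)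
Definition H_norm (R : realType) (n : nat) (lam q : R) (f : Leb R n -> R)
  : \bar R :=
  Lnorm (lebn R n) q%:E (riesz lam f).

Definition loc_integrable (R : realType) (n : nat) (f : Leb R n -> R) : Prop :=
  forall K : set 'rV[R]_n, compact K ->
    (lebn R n).-integrable (K : set (Leb R n)) (EFin \o f).

(* Main.v *)
(* Write l(Q) for the side of Q and lambda = n(1/p - 1/q). For f >= 0 and x in Q the
   potential I_lambda f(x) is at least a constant times l(Q)^(lambda-n) int_Q f, and
   integrating the q-th power over the disjoint sets E_Q bounds the SR norm.

   Conversely |x-y|^(lambda-n) is at most a constant times the sum over all dyadic
   scales k of 2^(-k(lambda-n)) times the indicator that y lies in one of the 3^n
   neighbours of the cube of level k around x. The corresponding scale terms c_k of
   the potential have conditional expectations E[c_j | level i] bounded by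
   K 2^(-lambda(j-i)) c_i, and for such sequences
   int (sum_k c_k)^q <= C sum_k int c_k^q, by induction from q - 1 to q. This leaves
   the sum of |Q|^(-q/p') (int_Q |f|)^q over all dyadic cubes. Every Q is charged to
   an ancestor P that is the first one with an average of its own dyadic order of
   magnitude; as q > p, the cubes charged to P contribute a geometric series, and
   the cubes P split, by the parity of the order of magnitude of their averages, into
   two sparse families. *)
Require Import Defs.
From HB Require Import structures.
From mathcomp Require Import all_boot all_order all_algebra.
From mathcomp Require Import ring lra zify.
From mathcomp Require Import all_classical all_reals all_analysis.
From mathcomp Require Import measurable_realfun.
Set Implicit Arguments. Unset Strict Implicit. Unset Printing Implicit Defensive.
Import Order.TTheory GRing.Theory Num.Theory.
Import numFieldNormedType.Exports.
Local Open Scope classical_set_scope.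
Local Open Scope ring_scope.

(** * Boxes, scaling and half-spaces for the Lebesgue outer measure *)

(** For integer q one would expand the power of the sum over scales and order the levels; for real q
    the induction does this one factor at a time. The factor [c_k] peeled off becomes part of the
    weight, which is why the conditional expectations are stated through weights.

    The neighbours prevent an exact martingale structure: [c_k] is constant on cubes of level k but
    counts mass outside them. Since neighbouring cubes have neighbouring or equal ancestors, this
    costs only the factor [3^n] in K.

    There is no coarsest dyadic cube, so a first ancestor exists only after the levels below some L
    are cut off. All level sums are therefore truncated, to -N, ..., N - 1, with constants free of
    N, and the truncation is removed by monotone convergence. Besides giving the geometric series, q
    > p makes lambda positive, hence the decay rate smaller than 1. *)

Section outer_measure.
Context (R : realType) (n : nat).
Implicit Types (a b t : 'rV[R]_n) (s : R) (A X : set 'rV[R]_n).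

Lemma vol_box_le a b : (forall i, a ord0 i <= b ord0 i) ->
  (vol_box (box a b : set (Rall R n)) <= (\prod_(i < n) (b ord0 i - a ord0 i))%:E)%E.
Proof.
move=> ab; rewrite /vol_box; case: ifPn => _.
  by rewrite lee_fin prodr_ge0// => i _; rewrite subr_ge0.
by apply: ereal_inf_lbound; exists (a, b).
Qed.

Lemma le_vol_box X (z : \bar R) : X !=set0 ->
  (forall a b, (forall i, a ord0 i <= b ord0 i) -> X = box a b ->
    (z <= (\prod_(i < n) (b ord0 i - a ord0 i))%:E)%E) ->
  (z <= vol_box (X : set (Rall R n)))%E.
Proof.
move=> /set0P/eqP X0 h; rewrite /vol_box asboolF//.
by apply: le_ereal_inf_tmp => _ [[a b] /= [ab XE] <-]; exact: h.
Qed.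

Definition affine s t (x : 'rV[R]_n) : 'rV[R]_n := s *: x + t.

Lemma affine_box s t a b : 0 < s ->
  affine s t @` box a b = box (affine s t a) (affine s t b).
Proof.
move=> s0; apply/seteqP; split => [_ [x xab <-] i|x xab].
  by rewrite !mxE lerD2r ltrD2r ler_pM2l// ltr_pM2l//; exact: xab.
exists (s^-1 *: (x - t)); last first.
  by rewrite /affine scalerA mulfV ?gt_eqF// scale1r subrK.
move=> i; have := xab i; rewrite !mxE ler_pdivlMl// ltr_pdivrMl//.
by rewrite lerBrDr ltrBlDr.
Qed.

(** Scaling maps each representation of [X] as a box to one of its image; when [X] is not a box the
    right-hand side is infinite. *)
Lemma vol_box_affine s t X : 0 < s ->
  ((s^-1 ^+ n)%:E * vol_box (affine s t @` X : set (Rall R n)) <=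
   vol_box (X : set (Rall R n)))%E.
Proof.
move=> s0; have [->|X0] := eqVneq X set0.
  by rewrite image_set0 !vol_box0 mule0.
apply: le_vol_box; first exact/set0P.
move=> a b ab ->; rewrite affine_box//.
have := @vol_box_le (affine s t a) (affine s t b).
move=> /(_ _)/le_trans h.
rewrite exprVn -lee_pdivlMl ?invr_gt0 ?exprn_gt0// invrK.
apply: h => [i|]; first by rewrite !mxE lerD2r ler_pM2l.
rewrite -EFinM lee_fin.
have -> : s ^+ n = \prod_(i < n) s by rewrite prodr_const card_ord.
rewrite -big_split/=.
by apply: ler_prod => i _; rewrite !mxE; have := ab i; nra.
Qed.

Lemma leb_outer_affine_le s t X : 0 < s ->
  (leb_outer (affine s t @` X : set (Rall R n)) <=
   (s ^+ n)%:E * leb_outer (X : set (Rall R n)))%E.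
Proof.
move=> s0; rewrite -lee_pdivrMl ?exprn_gt0//.
apply: le_ereal_inf_tmp => _ [F [mF XF] <-].
rewrite -exprVn.
apply: (@le_trans _ _ (\sum_(k <oo) (s^-1 ^+ n)%:E *
    vol_box (affine s t @` F k : set (Rall R n)))%E); last first.
  apply: lee_nneseries => [k _|k _]; last exact: vol_box_affine.
  by move=> _; apply: mule_ge0; rewrite ?vol_box_ge0// lee_fin exprn_ge0 ?invr_ge0 ?ltW.
rewrite nneseriesZl; last by move=> *; exact: vol_box_ge0.
apply: lee_wpmul2l; first by rewrite lee_fin exprn_ge0// invr_ge0 ltW.
apply: ereal_inf_lbound; exists (fun k => affine s t @` F k) => //.
by split => // _ [x /XF [k _ Fx] <-]; exists k => //; exists x.
Qed.

(** The reverse inequality is the direct one for the inverse map, which is again affine with factor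
    [s^-1]. *)
Lemma leb_outer_affine s t X : 0 < s ->
  leb_outer (affine s t @` X : set (Rall R n)) =
   ((s ^+ n)%:E * leb_outer (X : set (Rall R n)))%E.
Proof.
move=> s0; apply/eqP; rewrite eq_le leb_outer_affine_le//=.
rewrite -lee_pdivlMl ?exprn_gt0// -exprVn.
have := @leb_outer_affine_le s^-1 (- s^-1 *: t) (affine s t @` X).
rewrite invr_gt0 => /(_ s0); congr (leb_outer _ <= _)%E.
have affK x : affine s^-1 (- s^-1 *: t) (affine s t x) = x.
  by rewrite /affine scalerDr scalerA mulVf ?gt_eqF// scale1r scaleNr addrK.
apply/seteqP; split => [_ [_ [x Xx <-] <-]|x Xx]; first by rewrite affK.
by exists (affine s t x); [exists x|exact: affK].
Qed.

(** Caratheodory's criterion: the hyperplane cuts every box of a cover into two boxes whose volumes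
    add up to that of the box. *)
Lemma halfspace_measurable (i : 'I_n) (u : R) :
  measurable ([set x : 'rV[R]_n | x ord0 i < u] : set (Leb R n)).
Proof.
set H := (X in measurable X).
apply: (@le_caratheodory_measurable R (Rall R n) (@leb_outer R n)) => X.
have split_box (B : set 'rV[R]_n) :
    (vol_box (B `&` H : set (Rall R n)) + vol_box (B `&` ~` H : set (Rall R n))
     <= vol_box (B : set (Rall R n)))%E.
  have [->|B0] := eqVneq B set0.
    by rewrite !set0I !vol_box0 adde0.
  apply: le_vol_box; first exact/set0P.
  (* [w] is [u] clamped to the i-th edge, so both pieces have ordered corners even if the hyperplane
     misses the box. *)
  move=> a b ab BE; pose w := Num.max (a ord0 i) (Num.min (b ord0 i) u).
  have aw : a ord0 i <= w by rewrite /w le_max lexx.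
  have wb : w <= b ord0 i by rewrite /w ge_max ab ge_min lexx.
  pose b' : 'rV[R]_n := \row_j if j == i then w else b ord0 j.
  pose a' : 'rV[R]_n := \row_j if j == i then w else a ord0 j.
  have -> : B `&` H = box a b'.
    rewrite BE; apply/seteqP; split => [x [/= xab xu] j|x xab].
      rewrite mxE; case: eqVneq => [->|_]; last exact: xab.
      have /andP[-> xb] := xab i.
      by rewrite /w lt_max lt_min xb xu orbT.
    have := xab i; rewrite mxE eqxx /w lt_max lt_min => /andP[ax].
    rewrite ltNge ax/= => /andP[xb xu]; split => // j.
    have := xab j; rewrite mxE; case: eqVneq => [->|//] /andP[-> _].
    by rewrite xb.
  have -> : B `&` ~` H = box a' b.
    rewrite BE; apply/seteqP; split => [x [/= xab xu] j|x xab].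
      rewrite mxE; case: eqVneq => [->|_]; last exact: xab.
      have /andP[ax ->] := xab i.
      rewrite andbT /w ge_max ge_min ax/=.
      by apply/orP; right; rewrite leNgt; exact/negP.
    have := xab i; rewrite mxE eqxx /w ge_max ge_min => /andP[/andP[ax]].
    move=> bu xb; rewrite leNgt xb/= in bu.
    split => [j|/=]; last by apply/negP; rewrite -leNgt.
    have := xab j; rewrite mxE; case: eqVneq => [->|//] /andP[_ ->].
    by rewrite ax.
  apply: le_trans; first apply: leeD.
  - by apply: vol_box_le => j; rewrite mxE; case: eqVneq => [->|].
  - by apply: vol_box_le => j; rewrite mxE; case: eqVneq => [->|].
  rewrite -EFinD lee_fin (bigD1 i)//= [X in _ + X](bigD1 i)//= [leRHS](bigD1 i)//=.
  rewrite !mxE eqxx.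
  rewrite (eq_bigr (fun j => b ord0 j - a ord0 j)) => [|j /negPf ji]; last first.
    by rewrite mxE ji.
  rewrite [X in _ + _ * X](eq_bigr (fun j => b ord0 j - a ord0 j)) => [|j /negPf ji]; last first.
    by rewrite mxE ji.
  by rewrite -mulrDl addrC addrA subrK.
apply: le_ereal_inf_tmp => _ [F [mF XF] <-].
have cov (K : set 'rV[R]_n) : (leb_outer (X `&` K : set (Rall R n)) <=
    \sum_(k <oo) vol_box (F k `&` K : set (Rall R n)))%E.
  apply: ereal_inf_lbound; exists (fun k => F k `&` K) => //.
  by split => // x [/XF[k _ Fx] Kx]; exists k.
apply: le_trans (leeD (cov H) (cov (~` H))) _.
rewrite -nneseriesD => [|k _ _|k _ _]; try exact: vol_box_ge0.
by apply: lee_nneseries => k _; rewrite ?adde_ge0 ?vol_box_ge0 ?split_box.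
Qed.

End outer_measure.

(** * Dyadic cubes *)

Section dyadic.
Context (R : realType) (n : nat).
Implicit Types (x y : Leb R n) (c : dcode n) (i j k : int) (s t : R).

Definition code0 : dcode n := (0%R : int, 0%R : 'rV[int]_n).

Definition side k : R := 2%:R ^ (- k).

Lemma side_gt0 k : 0 < side k. Proof. by rewrite /side exprz_gt0. Qed.

Lemma sideD i j : side (i + j) = side i * side j.
Proof. by rewrite /side opprD expfzDr ?pnatr_eq0. Qed.

Lemma exists_side t : 0 < t -> exists k, side (k + 1) <= t < side k.
Proof.
move=> t0; pose l := ln t / ln 2.
have l2 : 0 < ln 2 :> R by rewrite ln_gt0// ltr1n.
have powE (z : int) : 2%:R ^ z = expR (z%:~R * ln 2) :> R.
  by rewrite -powR_intmul ?ler0n// /powR pnatr_eq0.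
(* With [l] the binary logarithm of [t], the exponent [- (k + 1)] has to be the floor of [l]. *)
exists (- Num.floor l - 1).
have /andP[fl lf] := floor_itv l.
have tE : t = expR (l * ln 2) by rewrite /l mulfVK ?gt_eqF// lnK.
rewrite /side !powE addrNK !opprB opprK tE ler_expR ltr_expR ler_pM2r// ltr_pM2r//.
by rewrite fl /= [1 + _]addrC.
Qed.

Definition fl k t : int := Num.floor (t / side k).

Lemma flE k t (m : int) : (fl k t == m) = (m%:~R * side k <= t < (m%:~R + 1) * side k).
Proof.
by rewrite /fl floor_eq intrD ler_pdivlMr ?side_gt0// ltr_pdivrMr ?side_gt0.
Qed.

Lemma fl_ge k t (m : int) : (m <= fl k t) = (m%:~R * side k <= t).
Proof. by rewrite /fl floor_ge_int ler_pdivlMr ?side_gt0. Qed.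

(** Coarsening divides indices by a power of 2 and rounds down, so an index gap of at most [b] stays
    at most [b]. The case [b = 0] gives nesting of cubes, [b = 1] that ancestors of neighbours are
    neighbours or equal. *)
Lemma fl_coarsen i j s t (b : int) : i <= j -> 0 <= b ->
  fl j t <= fl j s + b -> fl i t <= fl i s + b.
Proof.
move=> ij b0 h; rewrite -lerBlDr fl_ge.
have [d jE] : exists d : nat, j = i + d%:Z.
  by exists `|j - i|%N; lia.
have N1 : 1 <= 2 ^+ d :> int by rewrite exprn_ege1.
have sE : side i = (2 ^+ d : int)%:~R * side j.
  by rewrite jE sideD mulrCA /side -exprnN rmorphXn/= mulfV ?mulr1// expf_neq0// pnatr_eq0.
have h1 : fl i t * 2 ^+ d <= fl j t.
  by rewrite fl_ge intrM -mulrA -sE -fl_ge.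
rewrite sE mulrA -intrM -fl_ge; nia.
Qed.

Definition code k x : dcode n := (k, \row_i fl k ((x : 'rV[R]_n) ord0 i)).

Lemma code_lvl k x : (code k x).1 = k. Proof. by []. Qed.

Lemma codeP k x y : code k x = code k y <->
  forall i : 'I_n, fl k ((x : 'rV[R]_n) ord0 i) = fl k ((y : 'rV[R]_n) ord0 i).
Proof.
split=> [[/rowP h] i|h]; first by have := h i; rewrite !mxE.
by congr pair; apply/rowP => i; rewrite !mxE.
Qed.

Lemma code_coarsen i j x y : i <= j -> code j x = code j y -> code i x = code i y.
Proof.
move=> ij /codeP h; apply/codeP => l; apply/eqP.
by rewrite eq_le -[leRHS]addr0 (@fl_coarsen _ j) ?h ?addr0//= -[leRHS]addr0 (@fl_coarsen _ j) ?h ?addr0.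
Qed.

Lemma dcubeP c x : dcube R c x <-> code c.1 x = c.
Proof.
case: c => k m; rewrite /dcube /code /=; split => [h|[/rowP h] i].
  congr pair; apply/rowP => i; rewrite mxE; apply/eqP; rewrite flE.
  by have [-> ->] := h i.
by have := h i; rewrite mxE => /eqP; rewrite flE => /andP.
Qed.

(** A canonical point of the cube, at which functions constant on cubes of a level are evaluated. *)
Definition corner c : Leb R n := \row_i ((c.2 ord0 i)%:~R * side c.1) : 'rV[R]_n.

Lemma code_corner c : code c.1 (corner c) = c.
Proof.
apply/dcubeP => i; rewrite /corner mxE; split => //.
by rewrite ltr_pM2r ?side_gt0// ltrDl.
Qed.

(** Entries of [d] are 0, 1 or 2, so the offsets are -1, 0, 1: the [3^n] neighbours, the cube itself
    included. *)
Definition shift c (d : 'rV['I_3]_n) : dcode n :=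
  (c.1, \row_i (c.2 ord0 i + (d ord0 i)%:Z - 1)).

Lemma shift_inj d : injective (shift^~ d).
Proof.
move=> [k m] [k' m'] [-> /rowP h]; congr pair; apply/rowP => i.
by have := h i; rewrite !mxE => /addIr/addIr.
Qed.

(* The cubes of level k containing x and y coincide or touch. *)
Definition near_code k x y : Prop := forall i : 'I_n,
  fl k ((x : 'rV[R]_n) ord0 i) <= fl k ((y : 'rV[R]_n) ord0 i) + 1 /\
  fl k ((y : 'rV[R]_n) ord0 i) <= fl k ((x : 'rV[R]_n) ord0 i) + 1.

Lemma near_codeP k x y : near_code k x y <-> exists d, dcube R (shift (code k x) d) y.
Proof.
split=> [h|[d /dcubeP yx] i]; last first.
  move/(congr1 (fun c : dcode n => c.2 ord0 i)) : yx; rewrite !mxE/=.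
  have := ltn_ord (d ord0 i); lia.
exists (\row_i inord `|(fl k ((y : 'rV[R]_n) ord0 i) + 1 - fl k ((x : 'rV[R]_n) ord0 i))%R|%N).
apply/dcubeP; congr pair; apply/rowP => i; rewrite !mxE/=.
have [h1 h2] := h i; set z := fl k _ + 1 - _.
have [m zE] : exists m : nat, z = m%:Z by exists `|z|%N; rewrite gez0_abs // /z; lia.
by rewrite zE absz_nat inordK; move: zE; rewrite /z; lia.
Qed.

Lemma near_code_coarsen i j x y : i <= j -> near_code j x y -> near_code i x y.
Proof. by move=> ij h l; have [h1 h2] := h l; split; exact: fl_coarsen h1 || exact: fl_coarsen h2. Qed.

Lemma near_code_dist k x y :
  (forall i : 'I_n, `|(x : 'rV[R]_n) ord0 i - (y : 'rV[R]_n) ord0 i| < side k) -> near_code k x y.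
Proof.
have key s t : `|s - t| < side k -> fl k s <= fl k t + 1.
  move=> h; rewrite -lerBlDr fl_ge intrB.
  have : (fl k s)%:~R * side k <= s by rewrite -fl_ge.
  by move: h; rewrite ltr_norml mulrBl mul1r; lra.
by move=> h i; split; apply: key; rewrite // distrC.
Qed.

Lemma dcube_dist c x y : dcube R c x -> dcube R c y ->
  forall i : 'I_n, `|(x : 'rV[R]_n) ord0 i - (y : 'rV[R]_n) ord0 i| <= side c.1.
Proof.
move=> hx hy i; have [x1 x2] := hx i; have [y1 y2] := hy i.
move: x1 x2 y1 y2; rewrite -/(side c.1) mulrDl mul1r ler_norml; lra.
Qed.

Lemma measurable_coord (i : 'I_n) :
  measurable_fun setT (fun x : Leb R n => (x : 'rV[R]_n) ord0 i).
Proof.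
apply: (@measurability _ _ (Leb R n) R setT _ _ (RGenInftyO.measurableE R)) => _ [_ [u ->] <-].
rewrite setTI (_ : _ @^-1` _ = [set x : 'rV[R]_n | x ord0 i < u]).
  exact: halfspace_measurable.
by apply/seteqP; split => x /=; rewrite in_itv.
Qed.

Lemma dcubeE c : dcube R c =
  \bigcap_(i in [set: 'I_n]) (fun x : Leb R n => (x : 'rV[R]_n) ord0 i) @^-1`
     `[(c.2 ord0 i)%:~R * side c.1, ((c.2 ord0 i)%:~R + 1) * side c.1[%classic.
Proof.
apply/seteqP; split => [x h i _|x h i]; last first.
  by have := h i I; rewrite /= in_itv/= => /andP.
by rewrite /= in_itv/=; apply/andP; exact: h.
Qed.

Lemma measurable_dcube c : measurable (dcube R c).
Proof.
rewrite dcubeE; apply: fin_bigcap_measurable => // i _.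
by rewrite -[X in measurable X]setTI; apply: measurable_coord.
Qed.

Lemma lebn_dcube_affine c : lebn R n (dcube R c) =
  ((side c.1 ^+ n)%:E * lebn R n (dcube R code0))%E.
Proof.
have := @leb_outer_affine R n (side c.1) (corner c) (dcube R code0) (side_gt0 _).
move=> <-; congr (leb_outer _); apply/seteqP.
have s0 := side_gt0 c.1.
split => [x /= h|_ [x h <-] i].
  exists ((side c.1)^-1 *: (x - corner c)); last first.
    by rewrite /affine scalerA mulfV ?gt_eqF// scale1r subrK.
  move=> i; have := h i; rewrite !mxE -/(side c.1) oppr0 expr0z mulr1 add0r mulr1.
  rewrite ler_pdivlMl// ltr_pdivrMl// mulr0 mulr1 mulrDl mul1r subr_ge0 ltrBlDr.
  by rewrite addrC.
have := h i; rewrite !mxE -/(side c.1) oppr0 expr0z mulr1 add0r mulr1 mulrDl mul1r.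
by move: s0 => /=; nra.
Qed.

(* The value vol1 = 1 is never needed, only the alternative vol1 = 0 or vol1 > 0:
   in the first case lebn would be null and all norms would vanish. *)
Definition vol1 : R := fine (lebn R n (dcube R code0)).

(** Only finiteness is at stake: one box followed by empty sets covers the unit cube. *)
Lemma vol1E : lebn R n (dcube R code0) = vol1%:E.
Proof.
rewrite fineK// ge0_fin_numE//; apply: (@le_lt_trans _ _ 1%E); last exact: ltey.
pose F (k : nat) : set (Rall R n) := if k is 0%N then box (const_mx 0) (const_mx 1) else set0.
apply: (@le_trans _ _ (\sum_(k <oo) vol_box (F k))%E).
  apply: ereal_inf_lbound; exists F => //; split => // x h.
  exists 0%N => // i; have := h i; rewrite !mxE oppr0 expr0z mulr1 add0r mulr1.
  by case => -> ->.
rewrite nneseries_recl => [|k _|//]; last exact: vol_box_ge0.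
rewrite eseries_cond/= eseries0 => [|[|k]//= _ _]; last exact: vol_box0.
rewrite adde0; apply: le_trans (vol_box_le _) _ => [i|]; first by rewrite !mxE.
by rewrite big1// => i _; rewrite !mxE subr0.
Qed.

Definition vol c : R := fine (lebn R n (dcube R c)).

Lemma volE c : lebn R n (dcube R c) = (vol c)%:E.
Proof. by rewrite /vol lebn_dcube_affine vol1E -EFinM. Qed.

Lemma vol_side c : vol c = side c.1 ^+ n * vol1.
Proof. by rewrite /vol lebn_dcube_affine vol1E -EFinM. Qed.

Lemma vol_gt0 c : 0 < vol1 -> 0 < vol c.
Proof. by move=> v0; rewrite vol_side mulr_gt0// exprn_gt0// side_gt0. Qed.

End dyadic.
Arguments corner R {n} c.
Arguments vol R {n} c.
Arguments vol1 R n : clear implicits.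

(** * Integrals and powers *)

Section integral_facts.
Context d (T : measurableType d) (R : realType) (mu : {measure set T -> \bar R}).
Implicit Types (A D : set T) (f g : T -> \bar R).
Local Open Scope ereal_scope.

(* The Riesz potential is never shown to be measurable; the integral of a
   nonnegative function is a supremum over the simple functions below it, hence
   monotone all the same. *)
Lemma nonmeasurable_le_integral D f g : (forall x, D x -> 0 <= f x) ->
  (forall x, D x -> f x <= g x) ->
  \int[mu]_(x in D) f x <= \int[mu]_(x in D) g x.
Proof.
move=> f0 fg; have g0 x : D x -> 0 <= g x by move=> Dx; apply: le_trans (fg x Dx); exact: f0.
rewrite !ge0_integralE//; apply: ereal_sup_le => _ [h /= hf <-].
exists h => // x; apply: le_trans (hf x) _.
by rewrite /patch; case: ifPn => // /[!inE]; exact: fg.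
Qed.

(** The left side is a supremum over finite subfamilies, so finite additivity suffices for any index
    type. *)
Lemma esum_integral_le (I : choiceType) (P : set I) (F : I -> set T) A g :
  (forall i, measurable (F i)) -> measurable A -> measurable_fun A g ->
  (forall x, A x -> 0 <= g x) -> (forall i, P i -> F i `<=` A) -> trivIset P F ->
  \esum_(i in P) \int[mu]_(x in F i) g x <= \int[mu]_(x in A) g x.
Proof.
move=> mF mA mg g0 FA tF; apply: ge_ereal_sup => _ [X [finX XP] <-].
have sub : \bigcup_(i in X) F i `<=` A by move=> x [i /XP Pi]; exact: FA.
rewrite -bigsetU_fset_set// in sub.
rewrite fsbig_finite//= -ge0_integral_bigsetU//.
- by apply: ge0_subset_integral => //; exact: bigsetU_measurable.
- by apply: sub_trivIset tF => i /=; rewrite in_fset_set// inE => /XP.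
- by apply: measurable_funS mg.
- by move=> x /sub; exact: g0.
Qed.

(** The family is reindexed by nat along [pickle], with the empty set at numbers that code no index
    in [P], and sigma-additivity applies. *)
Lemma integral_countable_bigcup (I : countType) (P : set I) (F : I -> set T) g :
  (forall i, measurable (F i)) -> measurable_fun setT g ->
  (forall x, 0 <= g x) -> trivIset P F ->
  \int[mu]_(x in \bigcup_(i in P) F i) g x = \esum_(i in P) \int[mu]_(x in F i) g x.
Proof.
move=> mF mg g0 tF.
pose G k := if pickle_inv k is Some i then (if i \in P then F i else set0) else set0.
have Gp i : P i -> G (pickle i) = F i by move=> Pi; rewrite /G pickleK_inv mem_set.
have GN k : ~ (pickle @` P) k -> G k = set0.
  rewrite /G; have := @pickle_invK I k; case: pickle_inv => [i /= ki kP|//].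
  by case: ifPn => // /[!inE] Pi; case: kP; exists i.
have GE : \bigcup_(i in P) F i = \bigcup_k G k.
  apply/seteqP; split => [x [i Pi Fx]|x [k _]]; first by exists (pickle i); rewrite ?Gp.
  by rewrite /G; case: pickle_inv => // i; case: ifPn => // /[!inE] Pi Fx; exists i.
rewrite GE ge0_integral_bigcup//.
- rewrite nneseries_esumT => [|k]; last exact: integral_ge0.
  transitivity (\esum_(k in pickle @` P) \int[mu]_(x in G k) g x).
    rewrite [RHS]esum_mkcond; apply: eq_esum => k _; case: ifPn => // /negP.
    by rewrite inE => /GN ->; rewrite integral_set0.
  rewrite esum_image => [|i j _ _ /(pcan_inj pickleK)//].
  by apply: eq_esum => i Pi; rewrite Gp.
- move=> k; rewrite /G; case: pickle_inv => // i; case: ifPn => // _; exact: measurable0.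
- exact: measurable_funTS.
apply/trivIsetP => k l _ _ kl; rewrite -subset0 => x [].
rewrite /G; have := @pickle_invK I k; case: pickle_inv => [i /= ki|//]; case: ifPn => // /[!inE] Pi Fi.
have := @pickle_invK I l; case: pickle_inv => [j /= lj|//]; case: ifPn => // /[!inE] Pj Fj.
have ij : i = j by apply: tF => //; exists x.
by move/eqP: kl; apply; rewrite -ki -lj ij.
Qed.

End integral_facts.

Section powR_facts.
Context (R : realType).
Implicit Types (a b t q : R).

Lemma powR_lt1 a q : 0 <= a < 1 -> 0 < q -> a `^ q < 1.
Proof.
move=> /andP[a0 a1] q0; have := gt0_ltr_powR q0 a0 (ler01 : 1 \in Num.nneg) a1.
by rewrite powR1.
Qed.

Lemma powR_exprn a q k : 0 <= a -> (a ^+ k) `^ q = (a `^ q) ^+ k.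
Proof.
by move=> a0; rewrite -(powR_mulrn _ a0) -powRrM mulrC powRrM powR_mulrn ?powR_ge0.
Qed.

(** With [s = a + b], each ratio [t / s] lies in [0, 1] and is at most its own q-th power; add this
    for [t = a] and [t = b]. *)
Lemma powR_subadditive q a b : 0 < q <= 1 -> 0 <= a -> 0 <= b ->
  (a + b) `^ q <= a `^ q + b `^ q.
Proof.
move=> /andP[q0 q1] a0 b0.
have [/eqP|s0] := eqVneq (a + b) 0.
  by rewrite paddr_eq0// => /andP[/eqP-> /eqP->]; rewrite addr0 lerDl powR_ge0.
have {}s0 : 0 < a + b by rewrite lt_neqAle eq_sym s0 addr_ge0.
set s := a + b in s0 *.
have key t : 0 <= t -> t <= s -> t / s * s `^ q <= t `^ q.
  rewrite le_eqVlt => /predU1P[<- _|t0 ts]; first by rewrite !mul0r powR_ge0.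
  have ts0 : 0 < t / s by rewrite divr_gt0.
  rewrite -[in leRHS](divfK (lt0r_neq0 s0) t) powRM ?(ltW ts0) ?(ltW s0)//.
  by rewrite ler_wpM2r ?powR_ge0// ger1_powR// ts0/= ler_pdivrMr// mul1r.
have /= := lerD (key a a0 _) (key b b0 _).
by rewrite -mulrDl -mulrDl -/s divff ?gt_eqF// mul1r; apply; rewrite /s ?lerDl ?lerDr.
Qed.

Lemma powR_sum_subadditive q (I : Type) (r : seq I) (F : I -> R) : 0 < q <= 1 ->
  (forall i, 0 <= F i) -> (\sum_(i <- r) F i) `^ q <= \sum_(i <- r) F i `^ q.
Proof.
move=> q01 F0; elim: r => [|i r IH].
  by rewrite !big_nil powR0// gt_eqF//; case/andP: q01.
rewrite !big_cons; apply: le_trans (powR_subadditive q01 _ _) _ => //.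
  exact: sumr_ge0.
by rewrite lerD2l.
Qed.

(** Substitute for the mean value theorem: with [t = a / b], Bernoulli gives
    [1 - t ^+ m <= m (1 - t)], and [t ^+ m] is at most the q-th power of [t]. *)
Lemma powR_increment q (m : nat) a b : 0 < q <= m%:R -> 0 <= a <= b ->
  b `^ q <= a `^ q + m%:R * (b - a) * b `^ (q - 1).
Proof.
move=> /andP[q0 qm] /andP[a0 ab].
have [b0|b0] := eqVneq b 0.
  by rewrite b0 powR0 ?gt_eqF// addr_ge0 ?powR_ge0// mulr_ge0 ?powR_ge0// mulr_ge0// subr_ge0 -b0.
have {}b0 : 0 < b by rewrite lt_neqAle eq_sym b0 (le_trans a0).
pose t := a / b.
have t0 : 0 <= t by rewrite divr_ge0// ltW.
have t1 : t <= 1 by rewrite ler_pdivrMr// mul1r.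
have aE : a = t * b by rewrite divfK ?gt_eqF.
have bern : 1 - t ^+ m <= m%:R * (1 - t).
  elim: {q0 qm} m => [|m IH]; first by rewrite expr0 subrr mul0r.
  rewrite exprS -natr1 mulrDl mul1r; move: (t ^+ m) (exprn_ge0 m t0) IH => u u0 IH.
  have : t * (1 - u) <= t * (m%:R * (1 - t)) by rewrite ler_wpM2l.
  have : t * (m%:R * (1 - t)) <= m%:R * (1 - t).
    by rewrite ler_piMl// mulr_ge0// subr_ge0.
  by lra.
have tq : t ^+ m <= t `^ q.
  move: t0; rewrite le_eqVlt => /predU1P[<-|t0].
    rewrite expr0n powR0 ?gt_eqF//; case: m {bern} qm => // qm.
    by rewrite leNgt q0 in qm.
  by rewrite -powR_mulrn ?(ltW t0)// ger_powR// t0.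
rewrite aE powRM// ?(ltW b0)//.
rewrite -(mulr_powRB1 (ltW b0) q0).
have B0 : 0 <= b `^ (q - 1) by exact: powR_ge0.
have : 1 <= t `^ q + m%:R * (1 - t) by lra.
move=> /(ler_wpM2r (mulr_ge0 (ltW b0) B0)); rewrite mul1r => /le_trans; apply.
by rewrite mulrDl lerD2l; lra.
Qed.

(* Split according to whether a is at most r^e b (for q >= 2) or b is at most r a
   (for q < 2); on the other side b^(q-2) is comparable to a^(q-2). With
   r = rho^(j-k), a = c_k and b = c_j this trades c_k c_j^(q-1), about which the
   decay hypothesis says nothing, for c_j c_k^(q-1), which it controls. *)
Lemma powR_pair q : 1 < q -> exists2 e, 0 < e <= 1 &
  forall r a b, 0 < r <= 1 -> 0 <= a -> 0 <= b ->
  a * b `^ (q - 1) <= r `^ (e - 1) * (b * a `^ (q - 1)) + r `^ e * (a `^ q + b `^ q).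
Proof.
move=> q1; have q0 : 0 < q by lra.
have aux e r a b : 0 < r <= 1 -> 0 <= a -> 0 <= b ->
    (a * b `^ (q - 1) <= r `^ e * (a `^ q + b `^ q) \/
     a * b `^ (q - 1) <= r `^ (e - 1) * (b * a `^ (q - 1))) ->
    a * b `^ (q - 1) <= r `^ (e - 1) * (b * a `^ (q - 1)) + r `^ e * (a `^ q + b `^ q).
  move=> r01 a0 b0 [/le_trans|/le_trans]; apply.
    by rewrite lerDr mulr_ge0 ?powR_ge0// mulr_ge0 ?powR_ge0.
  by rewrite lerDl mulr_ge0 ?powR_ge0// addr_ge0 ?powR_ge0.
have split_pow b : 0 < b -> b `^ (q - 1) = b * b `^ (q - 2).
  move=> b0; have -> : q - 2 = q - 1 - 1 by lra.
  by rewrite mulr_powRB1 ?(ltW b0)//; lra.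
have [q2|q2] := lerP 2 q.
- have e0 : 0 < (q - 1)^-1 by rewrite invr_gt0; lra.
  (* This exponent solves [e - 1 = - e (q - 2)]: when b is below [r^(-e) a], the power [b^(q-2)]
     costs exactly the factor [r^(e-1)]. *)
  exists (q - 1)^-1; first by rewrite e0/= invf_le1; lra.
  set e := (q - 1)^-1 in e0 *; move=> r a b /[dup] r01 /andP[r0 r1] a0 b0.
  apply: aux => //; have [ab|ba] := lerP a (r `^ e * b); [left|right].
    apply: (@le_trans _ _ (r `^ e * b `^ q)).
      by rewrite -(mulr_powRB1 b0 q0) mulrA ler_wpM2r ?powR_ge0.
    by rewrite ler_wpM2l ?powR_ge0// lerDr powR_ge0.
  have {}a0 : 0 < a by apply: le_lt_trans ba; rewrite mulr_ge0 ?powR_ge0.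
  move: b0; rewrite le_eqVlt => /predU1P[<-|b0].
    by rewrite powR0 ?mulr0 ?mul0r ?mulr0//; apply/eqP; lra.
  rewrite !split_pow//.
  have : b `^ (q - 2) <= r `^ (e - 1) * a `^ (q - 2).
    have -> : e - 1 = - e * (q - 2) by rewrite /e; field; apply/eqP; lra.
    rewrite powRrM -powRM ?powR_ge0 ?(ltW a0)//; apply: ge0_ler_powR.
    - lra.
    - exact: ltW.
    - by rewrite nnegrE mulr_ge0 ?powR_ge0 ?ltW.
    - by rewrite powRN mulrC ler_pdivlMr ?powR_gt0// mulrC ltW.
  move=> /(ler_wpM2l (mulr_ge0 (ltW a0) (ltW b0))); rewrite mulrA.
  by move=> /le_trans; apply; lra.
(* Now [q - 2] is negative, so [b > r a] bounds [b^(q-2)] from above, by [r^(q-2) a^(q-2)]; hence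
   [e - 1 = q - 2]. *)
- exists (q - 1) => [|r a b /[dup] r01 /andP[r0 r1] a0 b0]; first lra.
  apply: aux => //; have [ba|ab] := lerP b (r * a); [left|right].
    apply: (@le_trans _ _ (r `^ (q - 1) * a `^ q)).
      rewrite -(mulr_powRB1 a0 q0) mulrCA ler_wpM2l// -powRM ?(ltW r0)//.
      by apply: ge0_ler_powR => //; rewrite ?nnegrE ?mulr_ge0 ?(ltW r0)//; lra.
    by rewrite ler_wpM2l ?powR_ge0// lerDl powR_ge0.
  have {}b0 : 0 < b by apply: le_lt_trans ab; rewrite mulr_ge0// ltW.
  move: a0; rewrite le_eqVlt => /predU1P[<-|a0].
    by rewrite powR0 ?mulr0 ?mul0r ?mulr0//; apply/eqP; lra.
  rewrite !split_pow//.
  have : b `^ (q - 2) <= r `^ (q - 1 - 1) * a `^ (q - 2).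
    have -> : q - 1 - 1 = q - 2 by lra.
    rewrite -powRM ?(ltW a0) ?(ltW r0)//.
    have -> : q - 2 = - (2 - q) by lra.
    rewrite !powRN lef_pV2 ?posrE ?powR_gt0 ?mulr_gt0//.
    apply: ge0_ler_powR; rewrite ?nnegrE ?mulr_ge0 ?ltW//; lra.
  move=> /(ler_wpM2l (mulr_ge0 (ltW a0) (ltW b0))); rewrite mulrA.
  by move=> /le_trans; apply; lra.
Qed.

(** The sum is at most [#|I|] times its largest term; this works on both sides of [q = 1]. *)
Lemma powR_sum_le q (I : finType) (F : I -> R) : 0 < q ->
  (forall i, 0 <= F i) -> (\sum_i F i) `^ q <= #|I|%:R `^ q * \sum_i F i `^ q.
Proof.
move=> q0 F0.
have [I0|/card_gt0P[i0 _]] := posnP #|I|.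
  rewrite !big_pred0 ?mulr0 ?powR0 ?gt_eqF// => i; first by have := card0_eq I0 i.
  by have := card0_eq I0 i.
have [i _ im] := @Order.TotalTheory.arg_maxP _ R I i0 xpredT F isT.
apply: (@le_trans _ _ ((#|I|%:R * F i) `^ q)).
  have S0 : 0 <= \sum_i F i by exact: sumr_ge0.
  apply: ge0_ler_powR; rewrite ?nnegrE ?mulr_ge0 ?(ltW q0)//.
  rewrite -sum1_card natr_sum mulr_suml; apply: ler_sum => j _.
  by rewrite mul1r; exact: im.
rewrite powRM// ler_wpM2l ?powR_ge0// (bigD1 i)//= lerDl sumr_ge0// => j _.
exact: powR_ge0.
Qed.

End powR_facts.

(** * A Wolff-type inequality for sums with decaying conditional expectations *)

Section adapted_sums.
Context d (T : measurableType d) (R : realType) (mu : {measure set T -> \bar R}).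
Context (I : Type).
Implicit Types (pi : nat -> T -> I) (c : nat -> T -> R).

(** The fibres of [pi j] are the atoms of level [j]; being constant on them replaces measurability
    for a sub-sigma-algebra. *)
Definition adapted pi j (w : T -> R) := forall x y, pi j x = pi j y -> w x = w y.

Definition filtration pi :=
  (forall i j x y, (i <= j)%N -> pi j x = pi j y -> pi i x = pi i y) /\
  (forall j w, adapted pi j w -> measurable_fun setT w).

(* The integral condition says E[c_j | pi_i] <= K rho^(j-i) c_i, tested against
   pi_i-measurable weights. *)
Definition decaying pi (K rho : R) c :=
  [/\ forall j x, 0 <= c j x, forall j, adapted pi j (c j) &
      forall i j w, (i <= j)%N -> (forall x, 0 <= w x) -> adapted pi i w ->
        (\int[mu]_x (w x * c j x)%:E <=
         (K * rho ^+ (j - i))%:E * \int[mu]_x (w x * c i x)%:E)%E].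

Definition tail c i N x := \sum_(i <= j < N) c j x.

Lemma tail_ge0 c i N x : (forall j x, 0 <= c j x) -> 0 <= tail c i N x.
Proof. by move=> c0; apply: sumr_ge0. Qed.

(** Telescoping: consecutive tails differ by [c k x], and [powR_increment] bounds each difference of
    q-th powers. *)
Lemma tail_powR c (q : R) (m i N : nat) x : (forall j x, 0 <= c j x) -> 0 < q <= m%:R ->
  (tail c i N x) `^ q <= m%:R * \sum_(i <= k < N) c k x * (tail c k N x) `^ (q - 1).
Proof.
move=> c0 qm; have /andP[q0 _] := qm.
have [Ni|iN] := leqP N i.
  by rewrite /tail !big_geq// powR0 ?mulr0// gt_eqF.
elim: (N - i)%N {-2}i (leqnn (N - i)) => [|e IH] {iN}i iN.
  have Ni : (N <= i)%N by rewrite -subn_eq0 -leqn0.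
  by rewrite /tail !big_geq// powR0 ?mulr0// gt_eqF.
have [Ni|{}Ni] := leqP N i.
  by rewrite /tail !big_geq// powR0 ?mulr0// gt_eqF.
have Ei : tail c i N x = c i x + tail c i.+1 N x by rewrite /tail big_ltn.
rewrite [X in _ * X]big_ltn// mulrDr.
have h : 0 <= tail c i.+1 N x <= tail c i N x by rewrite tail_ge0//= Ei lerDr.
apply: le_trans (powR_increment qm h) _.
rewrite addrC lerD//; first by rewrite -mulrA Ei addrK.
by apply: IH; lia.
Qed.

Lemma measurable_weight pi j w c k (s : R) : filtration pi -> adapted pi j w ->
  (forall k, adapted pi k (c k)) ->
  measurable_fun setT (fun x => (w x * c k x `^ s)%:E).
Proof.
move=> [_ measurable_adapted] wj cj; apply/measurable_EFinP/measurable_funM; first exact: measurable_adapted _ _ wj.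
by apply: (measurableT_comp (measurable_powR s)); exact: measurable_adapted _ _ (cj k).
Qed.

Lemma measurable_tail pi c i N : filtration pi -> (forall k, adapted pi k (c k)) ->
  measurable_fun setT (tail c i N).
Proof. by move=> [_ measurable_adapted] cj; apply: measurable_sum => k; exact: measurable_adapted _ _ (cj k). Qed.

Definition kernel_geo (tau : R) (i j : nat) : R := if (i <= j)%N then tau ^+ (j - i) else 0.

Lemma kernel_geo_ge0 tau i j : 0 < tau < 1 -> 0 <= kernel_geo tau i j.
Proof. by move=> /andP[t0 _]; rewrite /kernel_geo; case: ifP => // _; rewrite exprn_ge0// ltW. Qed.

Lemma sum_kernel_geo_row tau i N : 0 < tau < 1 ->
  \sum_(0 <= j < N) kernel_geo tau i j <= (1 - tau)^-1.
Proof.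
move=> /andP[t0 t1].
(* Truncated subtraction keeps the closed form right for [N <= i], where both sides vanish. *)
suff : \sum_(0 <= j < N) kernel_geo tau i j <= (1 - tau ^+ (N - i)) / (1 - tau).
  move/le_trans; apply; rewrite ler_pdivrMr ?subr_gt0// mulVf ?gt_eqF ?subr_gt0//.
  by rewrite lerBlDr lerDl exprn_ge0// ltW.
elim: N => [|N IH]; first by rewrite big_geq// sub0n expr0 subrr mul0r.
rewrite big_nat_recr//=; apply: le_trans (lerD IH (lexx _)) _.
rewrite /kernel_geo; case: leqP => iN.
  rewrite subSn// exprS -lerBrDl -mulrBl ler_pdivlMr ?subr_gt0//.
  by apply/eqP/eqP; lra.
have -> : (N.+1 - i = 0)%N by lia.
have -> : (N - i = 0)%N by lia.
by rewrite addr0.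
Qed.

Lemma sum_kernel_geo_col tau j N : 0 < tau < 1 ->
  \sum_(0 <= i < N) kernel_geo tau i j <= (1 - tau)^-1.
Proof.
move=> /andP[t0 t1].
(* The exponent is truncated at 0 once [N] passes [j], from where on the sum no longer grows. *)
suff : \sum_(0 <= i < N) kernel_geo tau i j <= tau ^+ (j.+1 - N) / (1 - tau).
  move/le_trans; apply; rewrite ler_pdivrMr ?subr_gt0// mulVf ?gt_eqF ?subr_gt0//.
  by rewrite exprn_ile1// ltW.
elim: N => [|N IH]; first by rewrite big_geq// divr_ge0 ?exprn_ge0 ?subr_ge0 ?ltW.
rewrite big_nat_recr//=; apply: le_trans (lerD IH (lexx _)) _.
rewrite /kernel_geo; case: leqP => jN.
  rewrite subSn// subSS exprS -lerBrDl -mulrBl ler_pdivlMr ?subr_gt0//.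
  by apply/eqP/eqP; lra.
have -> : (j.+1 - N.+1 = 0)%N by lia.
have -> : (j.+1 - N = 0)%N by lia.
by rewrite addr0.
Qed.

(** Schur's test: the part with [B k] uses the row sums, the part with [B j] the column sums, hence
    the factor 2. *)
Lemma sum_kernel_geo tau (B : nat -> \bar R) i N : 0 < tau < 1 -> (forall k, 0 <= B k)%E ->
  (\sum_(i <= k < N) \sum_(i <= j < N) (kernel_geo tau k j)%:E * (B k + B j) <=
   (2 / (1 - tau))%:E * \sum_(i <= k < N) B k)%E.
Proof.
move=> t01 B0; have t1 : 0 <= (1 - tau)^-1 by rewrite invr_ge0; lra.
have k0 a b : (0 <= (kernel_geo tau a b)%:E)%E by rewrite lee_fin kernel_geo_ge0.
have kg0 a b : 0 <= kernel_geo tau a b by exact: kernel_geo_ge0.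
have part (K : nat -> nat -> R) : (forall a b, 0 <= K a b) ->
    (forall a, \sum_(0 <= b < N) K a b <= (1 - tau)^-1) ->
    (\sum_(i <= k < N) \sum_(i <= j < N) (K k j)%:E * B k <=
     ((1 - tau)^-1)%:E * \sum_(i <= k < N) B k)%E.
  move=> K0 hK; rewrite ge0_sume_distrr => [|k _]; last exact: B0.
  apply: lee_sum => k _; rewrite -ge0_sume_distrl => [|j _]; last by rewrite lee_fin.
  rewrite lee_wpmul2r// sumEFin lee_fin; apply: le_trans (hK k).
  have [iN|Ni] := leqP i N; last by rewrite big_geq ?sumr_ge0// ltnW.
  by rewrite [leRHS](@big_cat_nat _ _ _ i)//= lerDr sumr_ge0.
under eq_bigr => k _ do under eq_bigr => j _ do rewrite ge0_muleDr//.
under eq_bigr => k _ do rewrite big_split/=.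
rewrite big_split/= mulr_natl mulr2n EFinD ge0_muleDl ?lee_fin//.
rewrite leeD//; first by apply: part => // a; exact: sum_kernel_geo_row.
rewrite exchange_big/=; apply: (part (fun a b => kernel_geo tau b a)) => // a.
exact: sum_kernel_geo_col.
Qed.

(* By tail_powR, (sum_j c_j)^q is controlled by the sum over k of c_k times the
   (q-1)-st power of the tail from k on; the hypothesis for the exponent q - 1 is
   applied to that tail with the adapted weight w c_k. *)
Lemma wolff_step (K rho q C : R) (m : nat) : 0 <= K -> 0 < rho < 1 -> 1 < q -> q <= m%:R -> 0 < C ->
  (forall pi, filtration pi -> forall c, decaying pi K rho c -> forall i N w,
    (forall x, 0 <= w x) -> adapted pi i w ->
    (\int[mu]_x (w x * tail c i N x `^ (q - 1))%:E <=
     C%:E * \sum_(i <= j < N) \int[mu]_x (w x * c j x `^ (q - 1))%:E)%E) ->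
  exists2 C', 0 < C' &
  (forall pi, filtration pi -> forall c, decaying pi K rho c -> forall i N w,
    (forall x, 0 <= w x) -> adapted pi i w ->
    (\int[mu]_x (w x * tail c i N x `^ q)%:E <=
     C'%:E * \sum_(i <= j < N) \int[mu]_x (w x * c j x `^ q)%:E)%E).
Proof.
move=> K0 /andP[rho0 rho1] q1 qm C0 IH.
have q0 : 0 < q by lra.
have m0 : 0 < m%:R :> R by lra.
have [e /andP[e0 e1] pair] := powR_pair q1.
(* The decay hypothesis contributes a factor [r = rho^(j-k)], which turns [r^(e-1)] into [r^e]; both
   parts of [powR_pair] then decay like [tau^(j-k)]. *)
pose tau := rho `^ e.
have t0 : 0 < tau by rewrite powR_gt0.
have t1 : tau < 1.
  by apply: powR_lt1 => //; rewrite ltW.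
have t01 : 0 < tau < 1 by rewrite t0.
(* [m] comes from [tail_powR], [C] from the exponent [q - 1], [K + 1] from [pair_int] and the rest
   from [sum_kernel_geo]. *)
exists (m%:R * C * ((K + 1) * (2 / (1 - tau)))).
  by rewrite !mulr_gt0 ?invr_gt0//; lra.
move=> pi /[dup] fpi [pi_refine measurable_adapted] c /[dup] hc [c0 cj cdec] i N w w0 wi.
(* The integrals are hidden behind an opaque [B], so that rewriting under integrals and sums leaves
   them alone. *)
have [B BE] : {B : nat -> \bar R | forall k, B k = (\int[mu]_x (w x * c k x `^ q)%:E)%E}.
  by exists (fun k => (\int[mu]_x (w x * c k x `^ q)%:E)%E).
under [X in (_ <= _ * X)%E]eq_bigr do rewrite -BE.
have B0 k : (0 <= B k)%E.
  by rewrite BE; apply: integral_ge0 => x _; rewrite lee_fin mulr_ge0 ?powR_ge0.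
have wk k : (i <= k)%N -> adapted pi k w by move=> ik x y /(pi_refine _ _ _ _ ik); exact: wi.
have wck k s : (i <= k)%N -> adapted pi k (fun x => w x * c k x `^ s).
  by move=> ik x y xy; rewrite (wk _ ik x y xy) (cj k x y xy).
have wck1 k : (i <= k)%N -> adapted pi k (fun x => w x * c k x).
  by move=> ik x y xy; rewrite (wk _ ik x y xy) (cj k x y xy).
have mw : measurable_fun setT w by exact: measurable_adapted _ _ wi.
have mc k : measurable_fun setT (c k) by exact: measurable_adapted _ _ (cj k).
have mcs k s : measurable_fun setT (fun x => c k x `^ s) by exact: measurableT_comp (measurable_powR s) (mc k).
have mt k s : measurable_fun setT (fun x => tail c k N x `^ s).
  by apply: (measurableT_comp (measurable_powR s)); exact: measurable_tail fpi cj.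
have pair_int k j : (i <= k)%N -> (k <= j)%N ->
    (\int[mu]_x (w x * c k x * c j x `^ (q - 1))%:E <=
     (K + 1)%:E * ((kernel_geo tau k j)%:E * (B k + B j)))%E.
  move=> ik kj; pose r := rho ^+ (j - k).
  have r0 : 0 < r by rewrite exprn_gt0.
  have r1 : r <= 1 by rewrite exprn_ile1// ltW.
  have reE : r `^ e = kernel_geo tau k j.
    by rewrite /kernel_geo kj /tau /r powR_exprn// ltW.
  apply: (@le_trans _ _ (\int[mu]_x ((r `^ (e - 1))%:E * (w x * c k x `^ (q - 1) * c j x)%:E +
      (r `^ e)%:E * ((w x * c k x `^ q)%:E + (w x * c j x `^ q)%:E)))%E).
    apply: nonmeasurable_le_integral => x _.
      by rewrite lee_fin !mulr_ge0 ?powR_ge0.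
    rewrite -[((w x * c k x `^ q)%:E + _)%E]EFinD -!EFinM -EFinD lee_fin.
    have := ler_wpM2l (w0 x) (pair r (c k x) (c j x) _ (c0 k x) (c0 j x)).
    rewrite r0 => /(_ r1); lra.
  have pos k' s : forall x : T, setT x -> (0 <= (w x * c k' x `^ s)%:E)%E.
    by move=> x _; rewrite lee_fin mulr_ge0 ?powR_ge0.
  have pos' x : (0 <= (w x * c k x `^ (q - 1) * c j x)%:E)%E.
    by rewrite lee_fin !mulr_ge0 ?powR_ge0.
  have m1 k' s : measurable_fun setT (fun x => (w x * c k' x `^ s)%:E).
    exact: measurable_weight fpi wi cj.
  have m2 : measurable_fun setT (fun x => (w x * c k x `^ (q - 1) * c j x)%:E).
    by apply/measurable_EFinP; apply: measurable_funM => //; exact: measurable_funM.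
  have re0 s : (0 <= (r `^ s)%:E)%E by rewrite lee_fin powR_ge0.
  rewrite ge0_integralD//; last first.
  - by apply: emeasurable_funM => //; apply: emeasurable_funD.
  - by move=> x _; rewrite mule_ge0// adde_ge0// lee_fin mulr_ge0 ?powR_ge0.
  - exact: emeasurable_funM.
  - by move=> x _; rewrite mule_ge0.
  have mE : measurable_fun setT (fun x => (w x * c k x `^ q)%:E + (w x * c j x `^ q)%:E)%E.
    exact: emeasurable_funD.
  have pE x : setT x -> (0 <= (w x * c k x `^ q)%:E + (w x * c j x `^ q)%:E)%E.
    by move=> _; rewrite adde_ge0//; exact: pos.
  rewrite ge0_integralZl// ge0_integralZl// ge0_integralD; [|by []|exact: pos|by []|exact: pos|by []].
  rewrite -!BE.
  (* This weight is adapted to level [k], and against [c k] it reproduces [B k]. *)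
  have := cdec k j (fun x => w x * c k x `^ (q - 1)) kj.
  move=> /(_ _ (wck _ _ ik)) dec.
  have {}dec : (\int[mu]_x (w x * c k x `^ (q - 1) * c j x)%:E <= (K * r)%:E * B k)%E.
    apply: le_trans (dec _) _ => [x|]; first by rewrite mulr_ge0 ?powR_ge0.
    rewrite BE -/r lee_wpmul2l ?lee_fin ?mulr_ge0 ?(ltW r0)//.
    by under eq_integral => x _ do rewrite -mulrA [X in w x * X]mulrC mulr_powRB1//.
  apply: (@le_trans _ _ ((r `^ (e - 1))%:E * ((K * r)%:E * B k) + (r `^ e)%:E * (B k + B j))%E).
    by rewrite leeD2r// lee_wpmul2l.
  have -> : ((r `^ (e - 1))%:E * ((K * r)%:E * B k) = (r `^ e)%:E * (K%:E * B k))%E.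
    rewrite !muleA -!EFinM; congr (_%:E * _)%E.
    by rewrite -[in RHS](mulr_powRB1 (ltW r0) e0); ring.
  rewrite reE [leRHS]muleCA -ge0_muleDr ?mule_ge0 ?adde_ge0 ?lee_fin//.
  rewrite lee_wpmul2l ?lee_fin ?kernel_geo_ge0// EFinD ge0_muleDl ?lee_fin ?adde_ge0//.
  by rewrite mul1e leeD2r// lee_wpmul2l ?lee_fin// leeDl.
have sum_k k : (i <= k)%N -> (\int[mu]_x (w x * c k x * tail c k N x `^ (q - 1))%:E <=
    C%:E * ((K + 1)%:E * \sum_(i <= j < N) (kernel_geo tau k j)%:E * (B k + B j)))%E.
  move=> ik; apply: le_trans (IH pi fpi c hc k N _ _ (wck1 _ ik)) _ => [x|]; first exact: mulr_ge0.
  rewrite lee_wpmul2l ?lee_fin ?(ltW C0)//.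
  have nn j : (0 <= (kernel_geo tau k j)%:E * (B k + B j))%E.
    by rewrite mule_ge0 ?adde_ge0// lee_fin kernel_geo_ge0.
  rewrite ge0_sume_distrr => [|j _]; last exact: nn.
  have [Nk|kN] := leqP N k.
    by rewrite big_geq// sume_ge0// => j _; rewrite mule_ge0// lee_fin; lra.
  rewrite [leRHS](@big_cat_nat _ _ _ k)//= ?(ltnW kN)//.
  rewrite -[leLHS]add0e; apply: leeD.
    by rewrite sume_ge0// => j _; rewrite mule_ge0// lee_fin; lra.
  rewrite big_nat_cond [leRHS]big_nat_cond; apply: lee_sum => j /andP[/andP[kj _] _].
  exact: pair_int.
apply: (@le_trans _ _ (\int[mu]_x (m%:R%:E * \sum_(i <= k < N)
    (w x * c k x * tail c k N x `^ (q - 1))%:E))%E).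
  apply: nonmeasurable_le_integral => x _; first by rewrite lee_fin mulr_ge0 ?powR_ge0.
  rewrite sumEFin -EFinM lee_fin.
  have := ler_wpM2l (w0 x) (@tail_powR c q m i N x c0 _).
  rewrite q0 qm => /(_ isT)/le_trans; apply.
  rewrite mulrCA mulr_sumr; under eq_bigr do rewrite mulrA.
  exact: lexx.
have pos k x : (0 <= (w x * c k x * tail c k N x `^ (q - 1))%:E)%E.
  by rewrite lee_fin !mulr_ge0 ?powR_ge0.
have mk k : measurable_fun setT (fun x => (w x * c k x * tail c k N x `^ (q - 1))%:E).
  by apply/measurable_EFinP; apply: measurable_funM => //; exact: measurable_funM.
rewrite ge0_integralZl//; last 2 first.
- exact: emeasurable_sum.
- by move=> x _; apply: sume_ge0.
rewrite ge0_integral_sum// -!mulrA !(EFinM m%:R) -muleA lee_wpmul2l ?lee_fin//.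
apply: (@le_trans _ _ (\sum_(i <= k < N) C%:E * ((K + 1)%:E * \sum_(i <= j < N)
    (kernel_geo tau k j)%:E * (B k + B j)))%E).
  by rewrite big_nat_cond [leRHS]big_nat_cond; apply: lee_sum => k /andP[/andP[ik _] _]; exact: sum_k.
have nn k : (0 <= \sum_(i <= j < N) (kernel_geo tau k j)%:E * (B k + B j))%E.
  by apply: sume_ge0 => j _; rewrite mule_ge0 ?adde_ge0// lee_fin kernel_geo_ge0.
have K1 : (0 <= (K + 1)%:E)%E by rewrite lee_fin; lra.
rewrite -ge0_sume_distrr => [|k _]; last by rewrite mule_ge0.
rewrite -ge0_sume_distrr => [|k _]; last exact: nn.
rewrite !EFinM -!muleA lee_wpmul2l ?lee_fin ?(ltW C0)// lee_wpmul2l//.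
by rewrite muleA -EFinM; exact: sum_kernel_geo.
Qed.

(** [C] must not depend on [i] or [w], which change within the induction, nor on [pi] and [c], which
    in the application depend on the truncation. *)
Lemma wolff (K rho q : R) : 0 <= K -> 0 < rho < 1 -> 0 < q -> exists2 C, 0 < C &
  (forall pi, filtration pi -> forall c, decaying pi K rho c -> forall i N w,
    (forall x, 0 <= w x) -> adapted pi i w ->
    (\int[mu]_x (w x * tail c i N x `^ q)%:E <=
     C%:E * \sum_(i <= j < N) \int[mu]_x (w x * c j x `^ q)%:E)%E).
Proof.
move=> K0 rho01 q0.
have [m qm] : exists m : nat, q <= m.+1%:R.
  by exists (Num.bound q); apply/ltW/(lt_le_trans (archi_boundP (ltW q0))); rewrite ler_nat.
elim: m q q0 qm => [|m IH] q q0 qm; last first.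
  (* The exponent [q - 1] has to stay positive, so [q <= 1] is sent down to the base case. *)
  have [q1|q1] := lerP q 1; first by apply: IH => //; apply: le_trans q1 _; rewrite ler1n.
  have [||C C0 hC] := IH (q - 1); first by lra.
    by move: qm; rewrite -natr1; lra.
  exact: (wolff_step K0 rho01 q1 qm C0 hC).
(* Base case [q <= 1]: the power is subadditive, which gives the constant 1. *)
exists 1 => // pi fpi c [c0 cj _] i N w w0 wi; rewrite mul1e.
rewrite -ge0_integral_sum//; last 2 first.
- by move=> k; exact: measurable_weight fpi wi cj.
- by move=> k x _; rewrite lee_fin mulr_ge0 ?powR_ge0.
apply: nonmeasurable_le_integral => x _; first by rewrite lee_fin mulr_ge0 ?powR_ge0.
rewrite sumEFin lee_fin -mulr_sumr ler_wpM2l// powR_sum_subadditive//.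
by rewrite q0.
Qed.

End adapted_sums.

(** * Sparse domination of the sum over all dyadic cubes *)

Section esum_facts.
Context (R : realType).
Local Open Scope ereal_scope.

Lemma esumZ_le (I : choiceType) (P : set I) (r : R) (a : I -> \bar R) : (0 <= r)%R ->
  (forall i, 0 <= a i) ->
  \esum_(i in P) (r%:E * a i) <= r%:E * \esum_(i in P) a i.
Proof.
move=> r0 a0; apply: ge_ereal_sup => _ [X [finX XP] <-].
rewrite -ge0_mule_fsumr//.
by rewrite lee_wpmul2l ?lee_fin// ereal_sup_ubound//; exists X.
Qed.

Lemma esum_subset (I : choiceType) (P Q : set I) (a : I -> \bar R) : P `<=` Q ->
  \esum_(i in P) a i <= \esum_(i in Q) a i.
Proof.
move=> PQ; apply: ereal_sup_le => _ [X [finX XP] <-]; exists X => //; split => //.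
exact: subset_trans PQ.
Qed.

(** Choosing one [j] for each covered index embeds these indices into the pairs. The alternative
    [a i = 0] lets cubes without mass stay uncovered. *)
Lemma esum_cover (I J : choiceType) (P : set I) (S : set J) (F : J -> set I) (a : I -> \bar R) :
  (forall i, 0 <= a i) -> (forall i, P i -> a i = 0 \/ exists2 j, S j & F j i) ->
  \esum_(i in P) a i <= \esum_(j in S) \esum_(i in F j) a i.
Proof.
move=> a0 cov; rewrite esum_esum//.
pose Q := [set i | exists2 j, S j & F j i].
apply: (@le_trans _ _ (\esum_(i in Q) a i)).
  rewrite esum_mkcond [leRHS]esum_mkcond; apply: le_esum => i _.
  case: ifPn => [|_]; last by case: ifPn.
  rewrite inE => /cov [->|Qi]; first by case: ifPn.
  by rewrite mem_set.
have [Q0|/set0P[i0 [j0 _ _]]] := eqVneq Q set0.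
  by rewrite Q0 esum_set0; exact: esum_ge0.
pose h i := xget j0 [set j | S j /\ F j i].
have hP i : Q i -> S (h i) /\ F (h i) i.
  by move=> [j Sj Fj]; exact: (@xgetPex _ j0 [set j | S j /\ F j i] (ex_intro _ j (conj Sj Fj))).
rewrite -(esum_image Q (fun i => (h i, i)) (fun k => a k.2)) => [|i i' _ _ [] //].
by apply: esum_subset => _ [i Qi <-]; exact: hP.
Qed.

Lemma esum_finType (I : finType) (a : I -> \bar R) : (forall i, 0 <= a i) ->
  \esum_(i in [set: I]) a i = \sum_i a i.
Proof.
move=> a0; have -> : [set: I] = [set` index_enum I].
  by apply/seteqP; split => // i _; rewrite /= mem_index_enum.
rewrite esum_fset//.
by rewrite -fsbig_seq// index_enum_uniq.
Qed.

End esum_facts.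

Section esum_measure.
Context d (T : measurableType d) (R : realType) (mu : {measure set T -> \bar R}).

Lemma measure_countable_bigcup (I : countType) (P : set I) (F : I -> set T) :
  (forall i, measurable (F i)) -> trivIset P F ->
  (mu (\bigcup_(i in P) F i) = \esum_(i in P) mu (F i))%E.
Proof.
move=> mF tF.
have one A : measurable A -> (\int[mu]_(x in A) (cst 1%E x) = mu A)%E.
  by move=> mA; rewrite integral_cst// mul1e.
have mU : measurable (\bigcup_(i in P) F i).
  rewrite bigcup_mkcond; apply: countable_bigcupT_measurable => [|i]; first exact: countableP.
  by case: ifP.
rewrite -one// integral_countable_bigcup//.
by apply: eq_esum => i _; rewrite one.
Qed.

End esum_measure.

Section levels.

Lemma parity_gap (s s' : int) (b : bool) :
  ((s %% 2)%Z == 0) = b -> ((s' %% 2)%Z == 0) = b -> s' < s -> s' + 1 <= s - 1.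
Proof. case: b; lia. Qed.

Lemma first_level (Q : int -> Prop) (a b : int) : a <= b -> Q b ->
  exists2 k, a <= k <= b /\ Q k & forall j, a <= j < k -> ~ Q j.
Proof.
move=> ab Qb.
have ex : exists d : nat, `[< Q (a + d%:Z) >].
  by exists `|b - a|%N; apply/asboolP; have -> : a + `|b - a|%N%:Z = b by lia.
case: (ex_minnP ex) => d /asboolP Qd dmin; exists (a + d%:Z).
  split => //; have : (d <= `|b - a|)%N.
    by apply: dmin; apply/asboolP; have -> : a + `|b - a|%N%:Z = b by lia.
  lia.
move=> j /andP[aj jd] Qj; have : (d <= `|j - a|)%N.
  by apply: dmin; apply/asboolP; have -> : a + `|j - a|%N%:Z = j by lia.
lia.
Qed.

Context (R : realType) (n : nat).
Implicit Types (c P : dcode n) (x : Leb R n).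

Lemma ler_side i j : (side R i <= side R j) = (j <= i).
Proof. by rewrite /side ler_eXz2l ?lerN2// ltr1n. Qed.

Lemma ltr_side i j : (side R i < side R j) = (j < i).
Proof. by rewrite !ltNge ler_side. Qed.

(** An ancestor only for [k <= c.1]; for larger [k] it is a subcube at the corner of [c]. *)
Definition anc k c : dcode n := code k (corner R c).

Lemma anc_code j k x : j <= k -> anc j (code k x) = code j x.
Proof. by move=> jk; apply: (code_coarsen jk); rewrite -[k in LHS](code_lvl k x) code_corner. Qed.

Lemma anc_self c : anc c.1 c = c. Proof. exact: code_corner. Qed.

Lemma anc_dcube k c x : k <= c.1 -> dcube R c x -> code k x = anc k c.
Proof. by move=> kc /dcubeP xc; rewrite -[in RHS]xc anc_code. Qed.

Lemma dcube_anc k c : k <= c.1 -> dcube R c `<=` dcube R (anc k c).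
Proof. by move=> kc x xc; apply/dcubeP; rewrite /= (anc_dcube kc xc). Qed.

Lemma trivIset_level k (S : set (dcode n)) : (forall c, S c -> c.1 = k) -> trivIset S (dcube R).
Proof.
move=> Sk c c' /Sk ck /Sk c'k [x [/dcubeP + /dcubeP]].
by rewrite ck c'k => -> ->.
Qed.

(* side decreases in its argument, so larger t have smaller lv t. *)
Definition lv (t : R) : int := xget 0 [set k | side R (k + 1) <= t < side R k].

Lemma lvP t : 0 < t -> side R (lv t + 1) <= t < side R (lv t).
Proof.
move=> /exists_side [k kt].
by have := @xgetPex _ 0 [set k | side R (k + 1) <= t < side R k] (ex_intro _ k kt).
Qed.

End levels.
Arguments anc R {n} k c.

(** * Masses, averages and the selection of sparse families *)

Section local_integrals.
Context (R : realType) (n : nat) (f : Leb R n -> R).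
Hypothesis locf : loc_integrable f.
Implicit Types (c P : dcode n) (x : Leb R n).

Let g x : \bar R := `|f x|%:E.

(** A half-open cube lies in its closed box [K], which is compact. *)
Lemma integrable_dcube c : (lebn R n).-integrable (dcube R c) (EFin \o f).
Proof.
pose K : set (Leb R n) := [set x : 'rV[R]_n | forall i : 'I_n,
  `[(c.2 ord0 i)%:~R * side R c.1, ((c.2 ord0 i)%:~R + 1) * side R c.1]%classic (x ord0 i)].
have mK : measurable K.
  rewrite (_ : K = \bigcap_(i in [set: 'I_n]) (fun x : Leb R n => (x : 'rV[R]_n) ord0 i) @^-1`
     `[(c.2 ord0 i)%:~R * side R c.1, ((c.2 ord0 i)%:~R + 1) * side R c.1]%classic).
    apply: fin_bigcap_measurable => // i _.
    by rewrite -[X in measurable X]setTI; apply: measurable_coord.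
  by apply/seteqP; split => [x h i _|x h i]; [exact: h|exact: h i I].
apply: (integrableS mK) => //.
- exact: measurable_dcube.
- move=> x h i; rewrite /= in_itv/=; have [-> xb] := h i.
  exact: ltW.
apply: locf; apply: (@rV_compact R n (fun i => `[(c.2 ord0 i)%:~R * side R c.1,
  ((c.2 ord0 i)%:~R + 1) * side R c.1]%classic)) => i.
exact: segment_compact.
Qed.

Lemma measurable_loc_integrable : measurable_fun setT f.
Proof.
pose E k : set (Leb R n) := if @pickle_inv (dcode n) k is Some c then dcube R c else set0.
have -> : [set: Leb R n] = \bigcup_k E k.
  apply/seteqP; split => // x _; exists (pickle (code 0 x)) => //.
  by rewrite /E pickleK_inv; apply/dcubeP.
apply/measurable_fun_bigcup => k; rewrite /E; case: pickle_inv => [c|].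
- exact: measurable_dcube.
- exact: measurable0.
- exact/measurable_EFinP/measurable_int/integrable_dcube.
- exact: measurable_fun_set0.
Qed.

Lemma measurable_abs_loc : measurable_fun setT g.
Proof. by apply/measurable_EFinP/measurableT_comp => //; exact: measurable_loc_integrable. Qed.

Definition mass c : R := fine (\int[lebn R n]_(x in dcube R c) g x)%E.

Lemma massE c : (\int[lebn R n]_(x in dcube R c) g x)%E = (mass c)%:E.
Proof.
rewrite fineK// ge0_fin_numE; last by apply: integral_ge0 => x _; rewrite lee_fin.
by have /integrableP[_] := integrable_dcube c.
Qed.

Lemma mass_ge0 c : 0 <= mass c.
Proof. by apply: fine_ge0; apply: integral_ge0 => x _; rewrite lee_fin. Qed.

Lemma esum_mass_le (S : set (dcode n)) P : (forall c, S c -> dcube R c `<=` dcube R P) ->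
  trivIset S (dcube R) -> (\esum_(c in S) (mass c)%:E <= (mass P)%:E)%E.
Proof.
move=> SP tS; rewrite -massE; under eq_esum => c _ do rewrite -massE.
apply: esum_integral_le => //.
- by move=> c; exact: measurable_dcube.
- exact: measurable_dcube.
- exact: measurable_funTS measurable_abs_loc.
- by move=> x _; rewrite lee_fin.
Qed.

Hypothesis v0 : 0 < vol1 R n.

Definition avg c : R := mass c / vol R c.

Lemma avg_gt0 c : (0 < avg c) = (0 < mass c).
Proof. by rewrite /avg pmulr_lgt0// invr_gt0 vol_gt0. Qed.

Lemma mass_avg c : mass c = avg c * vol R c.
Proof. by rewrite /avg divfK// gt_eqF// vol_gt0. Qed.

(** Weak-type bound of the dyadic maximal function inside [P]: the coarsest cubes of the family
    cover the same set, are disjoint, and each has measure at most its mass over [t]. *)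
Lemma weak_type P t : 0 < t ->
  (lebn R n (\bigcup_(c in [set c | [/\ (P.1 < c.1)%R, anc R P.1 c = P & (t <= avg c)%R]]) dcube R c)
   <= (mass P / t)%:E)%E.
Proof.
move=> t0; set B := [set c | _].
pose M := [set c | B c /\ forall k, P.1 < k < c.1 -> avg (anc R k c) < t].
have -> : \bigcup_(c in B) dcube R c = \bigcup_(c in M) dcube R c.
  apply/seteqP; split => [x [c [Pc cP tc] xc]|x [c [Bc _] xc]]; last by exists c.
  have [||k [/andP[Pk kc] tk] kmin] := @first_level (fun k => t <= avg (code k x)) (P.1 + 1) c.1.
  - by lia.
  - by rewrite (anc_dcube (lexx _) xc) anc_self.
  exists (code k x); last exact/dcubeP.
  have Pk' : P.1 < k by lia.
  split; first by split => //=; rewrite anc_code ?(ltW Pk')// (anc_dcube (ltW Pc) xc).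
  move=> j /andP[Pj jk]; rewrite ltNge; apply/negP.
  by rewrite anc_code ?(ltW jk)//; apply: kmin; move: jk => /=; lia.
have tM : trivIset M (dcube R).
  have key c c' x : M c -> M c' -> dcube R c x -> dcube R c' x -> ~ (c.1 < c'.1).
    move=> [[Pc _ tc] _] [_ c'M] xc xc' cc'.
    have := c'M c.1; rewrite Pc cc' => /(_ isT); rewrite ltNge => /negP; apply.
    by rewrite -(anc_dcube (ltW cc') xc') (anc_dcube (lexx _) xc) anc_self.
  move=> c c' Mc Mc' [x [xc xc']].
  have e : c.1 = c'.1.
    by apply/eqP; rewrite eq_le !leNgt; apply/andP; split; apply/negP; exact: (key _ _ x).
  by rewrite -(anc_self R c) -(anc_self R c') -!(anc_dcube (lexx _) _ (x := x))// e.
rewrite measure_countable_bigcup//; last by move=> c; exact: measurable_dcube.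
apply: (@le_trans _ _ (\esum_(c in M) (t^-1)%:E * (mass c)%:E)%E).
  apply: le_esum => c [[_ _ tc] _]; rewrite volE -EFinM lee_fin mulrC ler_pdivlMr// mulrC.
  by rewrite mass_avg; apply: ler_wpM2r tc; exact: ltW (vol_gt0 c v0).
have t1 : 0 <= t^-1 by rewrite invr_ge0 ltW.
apply: (le_trans (esumZ_le M (a := fun c => (mass c)%:E) t1 _)) => [c|].
  by rewrite lee_fin mass_ge0.
rewrite EFinM muleC lee_wpmul2r ?lee_fin ?invr_ge0 ?(ltW t0)//.
apply: esum_mass_le => // c [[Pc cP _] _]; rewrite -cP.
by apply: dcube_anc; exact: ltW.
Qed.

(* The cubes whose average exceeds, by dyadic order of magnitude, the average of
   every ancestor down to level L. *)
Definition selected (L : int) : set (dcode n) := [set P | [/\ L <= P.1, 0 < mass P &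
  forall k, L <= k < P.1 -> avg (anc R k P) < side R (lv (avg P) + 1)]].

(* Among nested selected cubes whose lv has the same parity, lv drops by at least 2,
   so the average at least doubles and the weak-type bound leaves each cube half of
   its mass. *)
Definition parity (b : bool) : set (dcode n) := [set P | ((lv (avg P) %% 2)%Z == 0) = b].

Lemma selected_sparse L b : sparse R (selected L `&` parity b).
Proof.
split; first exact: countableP.
(* The threshold equals [2 * side (lv (avg P))], more than twice [avg P], so [weak_type] leaves
   [U P] at most half of the measure of [P]. *)
pose U P := \bigcup_(c in [set c | [/\ P.1 < c.1, anc R P.1 c = P & side R (lv (avg P) - 1) <= avg c]])
  dcube R c.
have mU P : measurable (U P).
  rewrite /U bigcup_mkcond; apply: countable_bigcupT_measurable => [|c]; first exact: countableP.
  by case: ifP => // _; exact: measurable_dcube.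
exists (fun P => dcube R P `\` U P); split => [P [[_ mP _] _]|].
  have mD := measurableD (measurable_dcube P) (mU P).
  split => //; split; first by move=> x [].
  have aP : 0 < avg P by rewrite avg_gt0.
  have /andP[_ hlv] := lvP aP.
  have hU : (lebn R n (U P) <= (2^-1 * vol R P)%:E)%E.
    apply: le_trans (weak_type P (side_gt0 R (lv (avg P) - 1))) _.
    rewrite lee_fin ler_pdivrMr ?side_gt0//.
    have -> : side R (lv (avg P) - 1) = 2 * side R (lv (avg P)).
      by rewrite sideD mulrC /side opprK expr1z.
    rewrite mulrACA mulVf ?pnatr_eq0// mul1r mulrC.
    by rewrite mass_avg; apply: ler_wpM2r (ltW hlv); exact: ltW (vol_gt0 P v0).
  have : (lebn R n (dcube R P) <= lebn R n (dcube R P `\` U P) + lebn R n (U P))%E.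
    apply: le_trans (measureU2 _ _ _) => //; apply: le_measure; rewrite ?inE.
    - exact: measurable_dcube.
    - exact: measurableU.
    - by move=> x Px; case: (pselect (U P x)) => Ux; [right|left].
  move=> /le_trans/(_ (leeD2l _ hU)); rewrite volE -EFinM => h.
  rewrite -leeBlDr// -EFinB in h; apply: le_trans h; rewrite lee_fin.
  by rewrite -[X in _ <= X - _]mul1r -mulrBl (_ : 1 - 2^-1 = 2^-1)//; lra.
move=> P P' [SP bP] [SP' bP'] PP'; rewrite -subset0 => x [[xP xU] [xP' xU']].
(* A strictly smaller cube of the family inside [Q] is one of those removed in [U Q]: [lv] drops,
   and by parity it drops by at least 2. *)
have key Q Q' : selected L Q -> parity b Q -> selected L Q' -> parity b Q' ->
    dcube R Q x -> dcube R Q' x -> ~ U Q x -> ~ (Q.1 < Q'.1).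
  move=> [LQ mQ _] bQ [_ mQ' Qmax] bQ' xQ xQ' nU QQ'; apply: nU; exists Q' => //.
  have QE : anc R Q.1 Q' = Q.
    by rewrite -(anc_dcube (ltW QQ') xQ') (anc_dcube (lexx _) xQ) anc_self.
  have := Qmax Q.1; rewrite LQ QQ' => /(_ isT); rewrite QE => lt1.
  have aQ : 0 < avg Q by rewrite avg_gt0.
  have aQ' : 0 < avg Q' by rewrite avg_gt0.
  have /andP[l1 _] := lvP aQ; have /andP[l2 _] := lvP aQ'.
  have := le_lt_trans l1 lt1; rewrite ltr_side => lvlt.
  split => //; apply: le_trans l2; rewrite ler_side.
  by move: bQ bQ' lvlt; rewrite ltrD2r; exact: parity_gap.
have e : P.1 = P'.1.
  apply/eqP; rewrite eq_le !leNgt; apply/andP; split; apply/negP.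
    exact: (key P' P).
  exact: (key P P').
by apply: PP'; rewrite -(anc_self R P) -(anc_self R P') -!(anc_dcube (lexx _) _ (x := x))// e.
Qed.

(** [P] is the first ancestor from level [L] on whose average reaches [side (s + 1)], the lower end
    of the dyadic range of [avg c]. Earlier ancestors stay below that value, hence below the range
    of [avg P]; the width of the range gives the factor 2. *)
Lemma selected_cover L c : L <= c.1 -> 0 < mass c ->
  exists2 P, selected L P & [/\ P.1 <= c.1, anc R P.1 c = P & avg c <= 2 * avg P].
Proof.
move=> Lc mc; have ac : 0 < avg c by rewrite avg_gt0.
have /andP[s1 s2] := lvP ac; set s := lv (avg c) in s1 s2.
have [|k [/andP[Lk kc] sk] kmin] :=
  @first_level (fun k => side R (s + 1) <= avg (anc R k c)) L c.1 Lc.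
  by rewrite anc_self.
have aP : 0 < avg (anc R k c) by apply: lt_le_trans sk; exact: side_gt0.
have /andP[_ t2] := lvP aP.
exists (anc R k c).
  split => //; first by rewrite -avg_gt0.
  move=> j /andP[Lj jk]; have -> : anc R j (anc R k c) = anc R j c by exact: anc_code (ltW jk).
  apply: (@lt_le_trans _ _ (side R (s + 1))).
    by rewrite ltNge; apply/negP; apply: kmin; rewrite Lj.
  have := le_lt_trans sk t2; rewrite ltr_side ler_side /anc; lia.
split => //; apply: ltW; apply: lt_le_trans s2 _; apply: le_trans (ler_wpM2l _ sk) => //.
by rewrite sideD mulrCA /side mulfV ?mulr1.
Qed.

End local_integrals.

Section sparse_domination.
Context (R : realType) (n : nat).
Hypothesis n_gt0 : (0 < n)%N.
Hypothesis v0 : 0 < vol1 R n.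
Context (p q : R).
Hypothesis p1 : 1 <= p.
Hypothesis pq : p < q.
Implicit Types (c P : dcode n) (f : Leb R n -> R).

Let q0 : 0 < q. Proof. exact: lt_trans (lt_le_trans ltr01 p1) pq. Qed.
Let p0 : 0 < p. Proof. exact: lt_le_trans ltr01 p1. Qed.
Let q1 : 0 < q - 1. Proof. by rewrite subr_gt0 (le_lt_trans p1). Qed.

(* kap = - q / p', so that beta below is the term |Q|^(-q/p') (int_Q |f|)^q of SR_norm. *)
Definition kap : R := q * (p^-1 - 1).
(** The exponent of the volume in [beta] once one factor [mass] is kept and the other [q - 1] are
    written as average times volume. *)
Definition sig : R := q / p - 1.

Lemma sig_gt0 : 0 < sig. Proof. by rewrite subr_gt0 ltr_pdivlMr// mul1r. Qed.

Lemma kap_sig : kap + (q - 1) = sig.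
Proof. by rewrite /kap /sig mulrBr mulr1 addrA subrK. Qed.

Definition beta f c : R := vol R c `^ kap * mass f c `^ q.

Lemma beta_ge0 f c : 0 <= beta f c.
Proof. by rewrite mulr_ge0 ?powR_ge0. Qed.

Lemma betaE f c : loc_integrable f ->
  ((((fine (lebn R n (dcube R c))) `^ (- (1 - p^-1)))%:E *
    \int[lebn R n]_(x in dcube R c) `|f x|%:E) `^ q = (beta f c)%:E)%E.
Proof.
move=> locf; rewrite massE// -EFinM poweR_EFin powRM ?powR_ge0 ?mass_ge0// -powRrM.
by rewrite opprB [(_ - _) * q]mulrC.
Qed.

Lemma esum_beta_sparse f (S : set (dcode n)) : loc_integrable f -> sparse R S ->
  (\esum_(c in S) (beta f c)%:E <= SR_norm p q f `^ q)%E.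
Proof.
move=> locf sS; set s := (X in (X <= _)%E).
have s0 : (0 <= s)%E by apply: esum_ge0 => c _; rewrite lee_fin beta_ge0.
have -> : s = ((s `^ q^-1) `^ q)%E by rewrite -poweRrM mulVf ?gt_eqF// poweRe1.
have h : (s `^ q^-1 <= SR_norm p q f)%E.
  apply: ereal_sup_ubound; exists S => //; congr (_ `^ _)%E.
  by apply: eq_esum => c _; rewrite betaE.
apply: gt0_ler_poweR => //; rewrite ?in_itv/= ?leey ?andbT ?poweR_ge0//; first exact: ltW.
by apply: le_trans h; exact: poweR_ge0.
Qed.

(** The gain per generation: volumes shrink by [2^-n], taken to the power [sig]. *)
Definition tau : R := (side R 1 ^+ n) `^ sig.

Lemma side1 : side R 1 = 2^-1. Proof. by rewrite /side exprN1. Qed.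

Lemma side_nat (d : nat) : side R d = side R 1 ^+ d.
Proof. by rewrite side1 /side -invr_expz exprVn. Qed.

Lemma tau_itv : 0 < tau < 1.
Proof.
have s1 : 0 < side R 1 ^+ n by rewrite exprn_gt0// side_gt0.
rewrite powR_gt0//=; apply: powR_lt1; last exact: sig_gt0.
by rewrite ltW//= exprn_ilt1 ?side1 ?invr_ge0 ?ler0n -?lt0n// invf_lt1 ?ltr1n.
Qed.

(** Of the q factors [mass f c] only [q - 1] are bounded by averages. One is kept, so that the
    masses of disjoint cubes of a generation can be added up. *)
Lemma beta_descendant f P c (d : nat) : 0 < mass f P -> c.1 = P.1 + d%:Z ->
  avg f c <= 2 * avg f P ->
  beta f c <= 2 `^ (q - 1) * tau ^+ d * (beta f P / mass f P) * mass f c.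
Proof.
move=> mP cP hc.
have V0 : 0 < vol R P by exact: vol_gt0.
pose eta := (side R 1 ^+ n) ^+ d.
have eta0 : 0 < eta by rewrite !exprn_gt0// side_gt0.
have volc : vol R c = eta * vol R P.
  rewrite !vol_side cP sideD exprMn side_nat mulrCA mulrA /eta -!exprM.
  by rewrite [(d * n)%N]mulnC; ring.
have a0 := mass_ge0 f c.
have hm : mass f c <= 2 * eta * mass f P.
  rewrite (mass_avg f v0 c) volc (mass_avg f v0 P) -/(vol R P).
  have : avg f c * (eta * vol R P) <= 2 * avg f P * (eta * vol R P).
    by apply: ler_wpM2r => //; rewrite mulr_ge0// ltW.
  by move/le_trans; apply; rewrite le_eqVlt; apply/orP; left; apply/eqP; ring.
have tauE : tau ^+ d = eta `^ kap * eta `^ (q - 1).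
  rewrite -powR_exprn; last by rewrite exprn_ge0// ltW// side_gt0.
  rewrite -/eta -powRD; last by rewrite (gt_eqF eta0) implybT.
  by rewrite kap_sig.
have bP : beta f P / mass f P = vol R P `^ kap * mass f P `^ (q - 1).
  rewrite /beta -[in LHS](mulr_powRB1 (ltW mP) q0); field; exact: lt0r_neq0.
rewrite bP tauE /beta volc -(mulr_powRB1 a0 q0) powRM ?(ltW eta0) ?(ltW V0)//.
have : mass f c `^ (q - 1) <= 2 `^ (q - 1) * eta `^ (q - 1) * mass f P `^ (q - 1).
  rewrite -powRM ?(ltW eta0)// -powRM ?mulr_ge0 ?(ltW eta0) ?(ltW mP)//.
  apply: ge0_ler_powR => //; rewrite ?nnegrE ?(ltW q1)//.
  by rewrite !mulr_ge0// ltW.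
move=> /(ler_wpM2l (mulr_ge0 (mulr_ge0 (powR_ge0 eta kap) (powR_ge0 (vol R P) kap)) a0)).
rewrite mulrA => /le_trans; apply.
by rewrite le_eqVlt; apply/orP; left; apply/eqP; ring.
Qed.

Definition Cgeo : R := 2 `^ (q - 1) / (1 - tau).

Lemma Cgeo_gt0 : 0 < Cgeo.
Proof. by have /andP[_ t1] := tau_itv; rewrite divr_gt0 ?powR_gt0// subr_gt0. Qed.

(** Descendants of every generation, [P] included, that may be charged to [P]. *)
Definition children f P : set (dcode n) :=
  [set c | [/\ P.1 <= c.1, anc R P.1 c = P & avg f c <= 2 * avg f P]].

(** The descendants are grouped by generation [d]: their masses add up to at most [mass f P], which
    leaves a geometric series in [tau]. *)
Lemma esum_children f P : loc_integrable f -> 0 < mass f P ->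
  (\esum_(c in children f P) (beta f c)%:E <= (Cgeo * beta f P)%:E)%E.
Proof.
move=> locf mP; pose F (d : nat) := [set c | [/\ c.1 = P.1 + d%:Z, anc R P.1 c = P &
  avg f c <= 2 * avg f P]].
apply: le_trans (@esum_cover R _ nat _ setT F _ _ _) _ => [c|c [Pc cP hc]|].
- by rewrite lee_fin beta_ge0.
- right; exists `|c.1 - P.1|%N => //; split => //.
  by rewrite gez0_abs ?subr_ge0// [RHS]addrC subrK.
have /andP[t0 t1] := tau_itv.
pose D := 2 `^ (q - 1) * beta f P.
have D0 : 0 <= D by rewrite mulr_ge0 ?powR_ge0 ?beta_ge0.
apply: (@le_trans _ _ (\esum_(d in [set: nat]) (D * tau ^+ d)%:E)%E).
  apply: le_esum => d _; pose r := 2 `^ (q - 1) * tau ^+ d * (beta f P / mass f P).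
  have r0 : 0 <= r by rewrite !mulr_ge0 ?powR_ge0 ?exprn_ge0 ?invr_ge0 ?beta_ge0 ?(ltW t0) ?(ltW mP).
  apply: (@le_trans _ _ (\esum_(c in F d) (r%:E * (mass f c)%:E))%E).
    by apply: le_esum => c [cP _ hc]; rewrite -EFinM lee_fin; exact: beta_descendant.
  apply: (le_trans (esumZ_le (F d) (a := fun c => (mass f c)%:E) r0 _)) => [c|].
    by rewrite lee_fin mass_ge0.
  have -> : (D * tau ^+ d)%:E = (r%:E * (mass f P)%:E)%E.
    by rewrite -EFinM; congr EFin; rewrite /D /r; field; exact: lt0r_neq0.
  rewrite lee_wpmul2l ?lee_fin//; apply: esum_mass_le => //.
    by move=> c [cP cPP _]; rewrite -cPP; apply: dcube_anc; rewrite cP; lia.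
  by apply: (@trivIset_level _ _ (P.1 + d%:Z)) => c [].
rewrite -nneseries_esumT; last by move=> d; rewrite lee_fin mulr_ge0// exprn_ge0// ltW.
apply: lime_le.
  by apply: is_cvg_nneseries => d _ _; rewrite lee_fin mulr_ge0// exprn_ge0// ltW.
apply: nearW => m; rewrite sumEFin lee_fin -mulr_sumr.
have -> : Cgeo * beta f P = D / (1 - tau) by rewrite /Cgeo /D mulrAC.
apply: ler_wpM2l => //.
have := sum_kernel_geo_row 0 m tau_itv.
by under eq_bigr => d _ do rewrite /kernel_geo leq0n subn0.
Qed.

(** The 2 counts the parity classes, each a sparse family. The bound is uniform in [L]. *)
Lemma esum_beta_levels f (L : int) : loc_integrable f ->
  (\esum_(c in [set c | (L <= c.1)%R]) (beta f c)%:E <= (2 * Cgeo)%:E * SR_norm p q f `^ q)%E.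
Proof.
move=> locf.
have b0 c : (0 <= (beta f c)%:E)%E by rewrite lee_fin beta_ge0.
apply: le_trans (@esum_cover R _ _ _ (selected f L) (children f) _ b0 _) _.
  move=> c /= Lc; have := mass_ge0 f c; rewrite le_eqVlt => /predU1P[m0|m0].
    by left; rewrite /beta -m0 powR0 ?mulr0// gt_eqF.
  by right; have [P] := selected_cover v0 Lc m0; exists P.
apply: (@le_trans _ _ (\esum_(P in selected f L) (Cgeo%:E * (beta f P)%:E))%E).
  by apply: le_esum => P [_ mP _]; rewrite -EFinM; exact: esum_children.
apply: (le_trans (esumZ_le (selected f L) (a := fun c => (beta f c)%:E) (ltW Cgeo_gt0) b0)).
have -> : ((2 * Cgeo)%:E * SR_norm p q f `^ q = Cgeo%:E * (2%:E * SR_norm p q f `^ q))%E.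
  by rewrite muleA -EFinM [(Cgeo * _)%R]mulrC.
apply: (@lee_wpmul2l R Cgeo%:E _).
  by rewrite lee_fin ltW// Cgeo_gt0.
rewrite (esumID (parity f true)) => [|c _]; last exact: b0.
have -> : (2%:E * SR_norm p q f `^ q = SR_norm p q f `^ q + SR_norm p q f `^ q)%E.
  by rewrite -[2%R]/(1 + 1)%R EFinD ge0_muleDl ?lee_fin// mul1e.
apply: leeD.
  by apply: esum_beta_sparse => //; exact: selected_sparse.
apply: le_trans (@esum_subset _ _ _ (selected f L `&` parity f false) _ _) _.
  by move=> P [SP]; split => //; move: b; rewrite /parity/=; case: eqP.
by apply: esum_beta_sparse => //; exact: selected_sparse.
Qed.

End sparse_domination.

(** * Averages over neighbouring cubes *)

Section levels_integral.
Context (R : realType) (n : nat).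
Implicit Types (c : dcode n) (x : Leb R n) (h : Leb R n -> \bar R).
Local Open Scope ereal_scope.

Definition descendants c (j : int) : set (dcode n) :=
  [set c' | c'.1 = j /\ anc R c.1 c' = c].

Lemma integral_descendants c j h : (c.1 <= j)%R -> measurable_fun setT h ->
  (forall x, 0 <= h x) ->
  \int[lebn R n]_(x in dcube R c) h x =
  \esum_(c' in descendants c j) \int[lebn R n]_(x in dcube R c') h x.
Proof.
move=> cj mh h0; rewrite -integral_countable_bigcup//.
- congr integral; apply/seteqP; split => [x xc|x [c' [cj' <-] xc']].
    exists (code j x); last exact/dcubeP.
    by split => //; rewrite anc_code// (anc_dcube (lexx _) xc) anc_self.
  by apply: dcube_anc xc'; rewrite cj'.
- by move=> c'; exact: measurable_dcube.
- by apply: (@trivIset_level _ _ j) => c' [].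
Qed.

Lemma integral_levels (k : int) h : measurable_fun setT h -> (forall x, 0 <= h x) ->
  \int[lebn R n]_x h x =
  \esum_(c in [set c | c.1 = k]) \int[lebn R n]_(x in dcube R c) h x.
Proof.
move=> mh h0; rewrite -integral_countable_bigcup//.
- congr integral; apply/seteqP; split => // x _.
  by exists (code k x) => //; exact/dcubeP.
- by move=> c'; exact: measurable_dcube.
- by apply: (@trivIset_level _ _ k) => c'.
Qed.

Lemma measurable_level (k : int) (w : Leb R n -> R) :
  (forall x y, code k x = code k y -> w x = w y) -> measurable_fun setT w.
Proof.
move=> wk _ B mB; rewrite setTI.
have -> : w @^-1` B = \bigcup_(c in [set c : dcode n | c.1 = k /\ B (w (corner R c))]) dcube R c.
  have wE x : w (corner R (code k x)) = w x by apply: wk; exact: code_corner (code k x).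
  apply/seteqP; split => [x Bx|x [c [ck Bc] /dcubeP xc]].
    by exists (code k x); [split => //; rewrite wE|exact/dcubeP].
  by rewrite /= -wE -[in code k x]ck xc.
rewrite bigcup_mkcond; apply: countable_bigcupT_measurable => [|c]; first exact: countableP.
by case: ifP => // _; exact: measurable_dcube.
Qed.

Lemma level_dcube (T : Type) (w : Leb R n -> T) c x :
  (forall x y, code c.1 x = code c.1 y -> w x = w y) -> dcube R c x ->
  w x = w (corner R c).
Proof. by move=> wk /dcubeP xc; apply: wk; rewrite xc code_corner. Qed.

Lemma integral_dcube_cst c (a : R) : (\int[lebn R n]_(x in dcube R c) a%:E = (a * vol R c)%:E).
Proof. by rewrite integral_cst ?volE//; exact: measurable_dcube. Qed.

Lemma integral_dcube_level c (w : Leb R n -> R) :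
  (forall x y, code c.1 x = code c.1 y -> w x = w y) ->
  (\int[lebn R n]_(x in dcube R c) (w x)%:E = (w (corner R c) * vol R c)%:E).
Proof.
move=> wk; rewrite -integral_dcube_cst; apply: eq_integral => x; rewrite inE => xc.
by rewrite (level_dcube wk xc).
Qed.

End levels_integral.

Section near_mass.
Context (R : realType) (n : nat) (f : Leb R n -> R).
Hypothesis locf : loc_integrable f.
Implicit Types (c : dcode n) (x : Leb R n).

Definition near_mass c : R := \sum_(d : 'rV['I_3]_n) mass f (shift c d).

Definition nshift : R := #|{: 'rV['I_3]_n}|%:R.

Lemma near_mass_ge0 c : 0 <= near_mass c.
Proof. by apply: sumr_ge0 => d _; exact: mass_ge0. Qed.

Lemma shift_corner c d : near_code c.1 (corner R c) (corner R (shift c d)).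
Proof.
by apply/near_codeP; exists d; rewrite code_corner; apply/dcubeP; exact: code_corner (shift c d).
Qed.

(** For fixed [d] the shifted descendants are distinct cubes of one level, each inside a neighbour
    of [c]; they are grouped by that neighbour. *)
Lemma esum_shift_le c j d : c.1 <= j ->
  (\esum_(c' in descendants R c j) (mass f (shift c' d))%:E <= (near_mass c)%:E)%E.
Proof.
move=> cj.
pose F e := [set c' | descendants R c j c' /\ anc R c.1 (shift c' d) = shift c e].
have m0 c' : (0 <= (mass f c')%:E)%E by rewrite lee_fin mass_ge0.
apply: le_trans (@esum_cover R _ {: 'rV['I_3]_n} _ setT F _ _ _) _ => [//|c' /[dup] hc' [c'j c'c]|].
  right; have /near_code_coarsen : near_code j (corner R c') (corner R (shift c' d)).
    by rewrite -c'j; exact: shift_corner.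
  move=> /(_ c.1 cj)/near_codeP[e /dcubeP he]; exists e => //; split => //.
  by rewrite /anc he; move: c'c; rewrite /anc => ->.
rewrite esum_finType => [|e]; last exact: esum_ge0.
rewrite -sumEFin; apply: lee_sum => e _.
rewrite -(esum_image (F e) (fun c => shift c d) (fun c => (mass f c)%:E)); last first.
  by move=> c1 c2 _ _; exact: shift_inj.
apply: esum_mass_le => //.
- by move=> _ [c' [[c'j _] <-] <-]; apply: dcube_anc; rewrite /= c'j.
- by apply: (@trivIset_level _ _ j) => _ [c' [[<- _] _] <-].
Qed.

Lemma esum_near_mass c j : c.1 <= j ->
  (\esum_(c' in descendants R c j) (near_mass c')%:E <= (nshift * near_mass c)%:E)%E.
Proof.
move=> cj; have m0 c' : (0 <= (mass f c')%:E)%E by rewrite lee_fin mass_ge0.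
under eq_esum => c' _ do rewrite /near_mass -sumEFin.
rewrite esum_sum//; apply: (@le_trans _ _ (\sum_(d : 'rV['I_3]_n) (near_mass c)%:E)%E).
  by apply: lee_sum => d _; exact: esum_shift_le.
by rewrite sumEFin lee_fin sumr_const mulr_natl.
Qed.

Context (e : R).

(** The contribution of scale [k] to the dyadic model of the potential of order [e] of [|f|]. *)
Definition scale_term k x : R := side R k `^ (e - n%:R) * near_mass (code k x).

Lemma scale_term_ge0 k x : 0 <= scale_term k x.
Proof. by rewrite mulr_ge0 ?powR_ge0 ?near_mass_ge0. Qed.

Lemma scale_term_level k x y : code k x = code k y -> scale_term k x = scale_term k y.
Proof. by rewrite /scale_term => ->. Qed.

Lemma measurable_scale_term k : measurable_fun setT (scale_term k).
Proof. by apply: (@measurable_level _ _ k) => x y; exact: scale_term_level. Qed.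

(** The volume cancels [side^(-n)], so the level enters only through [side^e] and the near mass;
    this is the source of the decay. *)
Lemma integral_scale_term c : (\int[lebn R n]_(x in dcube R c) (scale_term c.1 x)%:E =
  (vol1 R n * side R c.1 `^ e * near_mass c)%:E)%E.
Proof.
rewrite integral_dcube_level; last exact: scale_term_level.
congr EFin; rewrite /scale_term code_corner vol_side.
have -> : side R c.1 `^ e = side R c.1 `^ (e - n%:R) * side R c.1 ^+ n.
  rewrite -powR_mulrn ?ltW ?side_gt0// -powRD ?subrK//.
  by rewrite (gt_eqF (side_gt0 R c.1)) implybT.
by ring.
Qed.

Lemma vol1_ge0 : 0 <= vol1 R n.
Proof. exact: fine_ge0. Qed.

Lemma scale_term_decay_cube c (d : nat) :
  (\int[lebn R n]_(x in dcube R c) (scale_term (c.1 + d%:Z) x)%:E <=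
   (nshift * (side R 1 `^ e) ^+ d)%:E * \int[lebn R n]_(x in dcube R c) (scale_term c.1 x)%:E)%E.
Proof.
have cj : c.1 <= c.1 + d%:Z by rewrite lerDl.
rewrite (integral_descendants cj); last 2 first.
- exact/measurable_EFinP/measurable_scale_term.
- by move=> x; rewrite lee_fin scale_term_ge0.
pose r := vol1 R n * side R (c.1 + d%:Z) `^ e.
have r0 : 0 <= r by rewrite mulr_ge0 ?powR_ge0 ?vol1_ge0.
apply: (@le_trans _ _ (\esum_(c' in descendants R c (c.1 + d%:Z)) (r%:E * (near_mass c')%:E))%E).
  by apply: le_esum => c' [cj' _]; rewrite -EFinM /r -cj' integral_scale_term.
apply: (le_trans (esumZ_le (descendants R c (c.1 + d%:Z)) (a := fun c => (near_mass c)%:E) r0 _)) => [c'|].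
  by rewrite lee_fin near_mass_ge0.
apply: (@le_trans _ _ (r%:E * (nshift * near_mass c)%:E)%E).
  by rewrite lee_wpmul2l ?lee_fin//; exact: esum_near_mass.
rewrite integral_scale_term -!EFinM lee_fin /r sideD powRM ?(ltW (side_gt0 _ _))//.
have -> : side R d%:Z = side R 1 ^+ d.
  by rewrite /side exprN1 -invr_expz exprVn.
rewrite powR_exprn ?(ltW (side_gt0 _ _))//.
by rewrite le_eqVlt; apply/orP; left; apply/eqP; ring.
Qed.

(** Levels are integers while [decaying] counts from 0, hence the shift by [N]. On each cube of
    level [k] the weight is constant and leaves the integral. *)
Lemma scale_term_decaying (N : nat) :
  decaying (lebn R n) (fun t : nat => @code R n (t%:Z - N%:Z)) nshift (side R 1 `^ e)
    (fun t : nat => scale_term (t%:Z - N%:Z)).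
Proof.
split => [t x|t x y|i j w ij w0 wi]; [exact: scale_term_ge0|exact: scale_term_level|].
set k := i%:Z - N%:Z; pose d := (j - i)%N.
have kj : j%:Z - N%:Z = k + d%:Z by rewrite /k /d; lia.
have mw : measurable_fun setT w by exact: measurable_level wi.
have mh l : measurable_fun setT (fun x => (w x * scale_term l x)%:E).
  by apply/measurable_EFinP/measurable_funM => //; exact: measurable_scale_term.
have h0 l x : (0 <= (w x * scale_term l x)%:E)%E by rewrite lee_fin mulr_ge0 ?scale_term_ge0.
rewrite (integral_levels k)// [X in (_ <= _ * X)%E](integral_levels k)//.
have s0 : 0 <= nshift * side R 1 `^ e ^+ d.
  by rewrite mulr_ge0 ?exprn_ge0 ?powR_ge0 ?ler0n.
apply: le_trans; last first.
  apply: (@esumZ_le R _ [set c : dcode n | c.1 = k] _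
    (fun c => \int[lebn R n]_(x in dcube R c) (w x * scale_term k x)%:E)%E s0) => c.
  exact: integral_ge0.
apply: le_esum => c ck.
have scal l : (\int[lebn R n]_(x in dcube R c) (w x * scale_term l x)%:E =
    (w (corner R c))%:E * \int[lebn R n]_(x in dcube R c) (scale_term l x)%:E)%E.
  rewrite -ge0_integralZl ?lee_fin//.
  - apply: eq_integral => x; rewrite inE => xc; rewrite -EFinM (level_dcube (w := w) _ xc)//.
    by move=> y z; rewrite ck; exact: wi.
  - exact: measurable_dcube.
  - exact/measurable_funTS/measurable_EFinP/measurable_scale_term.
  - by move=> x _; rewrite lee_fin scale_term_ge0.
rewrite !scal kj muleCA; apply: lee_wpmul2l; first by rewrite lee_fin.
by move: ck => /= <-; exact: scale_term_decay_cube.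
Qed.

End near_mass.

(** * The dyadic model of the Riesz kernel *)

Section sup_integral.
Context d (T : measurableType d) (R : realType) (mu : {measure set T -> \bar R}).
Context (g : nat -> T -> \bar R).
Hypothesis mg : forall N, measurable_fun setT (g N).
Hypothesis nd_g : forall x, {homo g^~ x : N M / (N <= M)%N >-> (N <= M)%E}.
Local Open Scope ereal_scope.

Let cvg_sup x : g^~ x @ \oo --> ereal_sup (range (g^~ x)).
Proof. by apply: ereal_nondecreasing_cvgn => N M; exact: nd_g. Qed.

Lemma measurable_range_sup : measurable_fun setT (fun x => ereal_sup (range (g^~ x))).
Proof. by apply: (@emeasurable_fun_cvg _ _ _ _ g) => // x _; exact: cvg_sup. Qed.

Lemma integral_range_sup : (forall N x, 0 <= g N x) ->
  \int[mu]_x ereal_sup (range (g^~ x)) = ereal_sup (range (fun N => \int[mu]_x g N x)).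
Proof.
move=> g0; under eq_integral => x _ do rewrite -(cvg_lim (@ereal_hausdorff R) (cvg_sup (x := x))).
rewrite monotone_convergence//.
apply: cvg_lim => //; apply: ereal_nondecreasing_cvgn => N M NM.
by apply: nonmeasurable_le_integral => x _ //; exact: nd_g.
Qed.

End sup_integral.

Section level_sums.
Context (R : realType).
Implicit Types F : int -> R.

(* The sum of F over the levels -N, ..., N - 1. *)
Definition lsum F (N : nat) : R := \sum_(0 <= t < N.*2) F (t%:Z - N%:Z).

Lemma lsum_ge0 F N : (forall k, 0 <= F k) -> 0 <= lsum F N.
Proof. by move=> F0; exact: sumr_ge0. Qed.

(** Passing from [N] to [N + 1] adds one level at each end. *)
Lemma lsum_nd F : (forall k, 0 <= F k) -> {homo lsum F : N M / (N <= M)%N >-> N <= M}.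
Proof.
move=> F0; apply/nondecreasing_seqP => N.
rewrite /lsum doubleS big_nat_recr//= big_nat_recl//=.
apply: (@le_trans _ _ (\sum_(0 <= t < N.*2) F (t.+1%:Z - N.+1%:Z))).
  rewrite le_eqVlt; apply/orP; left; apply/eqP; apply: eq_bigr => t _; congr F; lia.
by rewrite -addrA addrCA lerDl addr_ge0.
Qed.

Lemma le_lsum F (k : int) N : (forall k, 0 <= F k) -> - N%:Z <= k < N%:Z -> F k <= lsum F N.
Proof.
move=> F0 kN; pose t0 := `|(k + N%:Z)%R|%N.
rewrite /lsum (bigD1_seq t0) ?iota_uniq//=; last by rewrite mem_index_iota /t0; lia.
have -> : t0%:Z - N%:Z = k by rewrite /t0; lia.
by rewrite lerDl sumr_ge0.
Qed.

(** A cube has one level, so it occurs in at most one inner sum, that of [t = c.1 + N]. *)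
Lemma lsum_esum (n : nat) (b : dcode n -> R) N : (forall c, 0 <= b c) ->
  (\sum_(0 <= t < N.*2) \esum_(c in [set c : dcode n | (c.1 = t%:Z - N%:Z)%R]) (b c)%:E <=
   \esum_(c in [set c : dcode n | (- N%:Z <= c.1)%R]) (b c)%:E)%E.
Proof.
move=> b0.
under eq_bigr => t _ do rewrite esum_mkcond.
rewrite -esum_sum; last by move=> c t _ _; case: ifP => // _; rewrite lee_fin.
rewrite [leRHS]esum_mkcond; apply: le_esum => c _.
have [cN|cN] := boolP (- N%:Z <= c.1); last first.
  rewrite [leRHS]ifF; last by apply/negbTE; rewrite notin_setE/=; exact/negP.
  rewrite big_nat big1// => t tN; rewrite ifF//; apply/negbTE; rewrite notin_setE/= => ct.
  by move: cN; rewrite ct; lia.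
rewrite [leRHS]ifT ?inE//.
rewrite (eq_bigr (fun t => if (t == `|(c.1 + N%:Z)%R|)%N then (b c)%:E else 0%E)); last first.
  move=> t _; congr (if _ then _ else _); apply/idP/idP.
    by rewrite inE /= => ->; lia.
  by move=> /eqP ->; rewrite inE /= gez0_abs ?addrK// -lerBlDr sub0r.
rewrite -big_mkcond big_nat1_eq; case: ifP => // _; by rewrite lee_fin.
Qed.

End level_sums.

Section riesz_kernel.
Context (R : realType) (n : nat).
Hypothesis n_gt0 : (0 < n)%N.
Implicit Types (x y : Leb R n) (c : dcode n).

Lemma edist_coord x y (i : 'I_n) :
  `|(x : 'rV[R]_n) ord0 i - (y : 'rV[R]_n) ord0 i| <= Defs.edist x y.
Proof.
rewrite -sqrtr_sqr /Defs.edist ler_sqrt; last by apply: sumr_ge0 => j _; exact: sqr_ge0.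
by rewrite (bigD1 i)//= lerDl sumr_ge0// => j _; exact: sqr_ge0.
Qed.

Lemma edist_le x y (s : R) : 0 <= s ->
  (forall i : 'I_n, `|(x : 'rV[R]_n) ord0 i - (y : 'rV[R]_n) ord0 i| <= s) ->
  Defs.edist x y <= n%:R * s.
Proof.
move=> s0 h; have ns0 : 0 <= n%:R * s by rewrite mulr_ge0.
rewrite -(ger0_norm ns0) -sqrtr_sqr ler_sqrt ?sqr_ge0//.
apply: (@le_trans _ _ (\sum_(i < n) s ^+ 2)).
  by apply: ler_sum => i _; rewrite -real_normK ?num_real// ler_sqr ?nnegrE.
rewrite sumr_const card_ord exprMn -[_ *+ n]mulr_natl ler_wpM2r ?sqr_ge0//.
by rewrite -natrX ler_nat; case: (n) n_gt0 => // m _; rewrite leq_pmulr.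
Qed.

Lemma edist_xx x : Defs.edist x x = 0.
Proof. by rewrite /Defs.edist big1 ?sqrtr0// => i _; rewrite subrr expr0n. Qed.

Lemma edist_gt0 x y : x <> y -> 0 < Defs.edist x y.
Proof.
move=> xy; rewrite ltNge; apply/negP => d0; apply: xy.
apply/rowP => i; apply/eqP; rewrite -subr_eq0 -normr_eq0 eq_le normr_ge0 andbT.
exact: le_trans (edist_coord x y i) d0.
Qed.

Lemma measurable_edist x : measurable_fun setT (Defs.edist x : Leb R n -> R).
Proof.
apply: (measurableT_comp (f := @Num.sqrt R)).
  exact: continuous_measurable_fun (@sqrt_continuous R).
apply: measurable_sum => i; apply: measurable_funX; apply: measurable_funB.
  exact: measurable_cst.
exact: measurable_coord.
Qed.

Lemma measurable_kernel x (s : R) : measurable_fun setT (fun y : Leb R n => Defs.edist x y `^ s).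
Proof. exact: measurableT_comp (measurable_powR s) (measurable_edist x). Qed.

Lemma measurable_riesz_integrand (f : Leb R n -> R) (lam : R) x :
  measurable_fun setT f -> measurable_fun setT (riesz_integrand lam f x).
Proof.
move=> mf; apply/measurable_EFinP; apply: measurable_funM; first exact: mf.
exact: measurable_kernel x (lam - n%:R).
Qed.

(** [k] is the dyadic order of the largest coordinate difference: all differences are below
    [side k], and the distance is at least the largest one. *)
Lemma exists_level x y : x <> y -> exists k, near_code k x y /\ side R (k + 1) <= Defs.edist x y.
Proof.
move=> xy; pose D i := `|(x : 'rV[R]_n) ord0 i - (y : 'rV[R]_n) ord0 i|.
have [i _ im] := @Order.TotalTheory.arg_maxP _ R 'I_n (Ordinal n_gt0) xpredT D isT.
have Di : 0 < D i.
  rewrite lt_neqAle eq_sym normr_ge0 andbT; apply/eqP => D0; apply: xy.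
  apply/rowP => j; apply/eqP; rewrite -subr_eq0 -normr_eq0 eq_le normr_ge0 andbT.
  by rewrite -D0; exact: im.
have [k /andP[kD Dk]] := exists_side Di; exists k; split.
  by apply: near_code_dist => j; apply: le_lt_trans Dk; exact: im.
by apply: le_trans kD _; exact: edist_coord.
Qed.

Context (f : Leb R n -> R).
Hypothesis locf : loc_integrable f.
Context (e : R).
Hypothesis en : e < n%:R.

Definition dkernel x N y : R := lsum (fun k => side R k `^ (e - n%:R) *
  \sum_(d : 'rV['I_3]_n) \1_(dcube R (shift (code k x) d)) y) N.

Lemma dkernel_term_ge0 x y k : 0 <= side R k `^ (e - n%:R) *
  \sum_(d : 'rV['I_3]_n) \1_(dcube R (shift (code k x) d)) y :> R.
Proof. by rewrite mulr_ge0 ?powR_ge0// sumr_ge0. Qed.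

Lemma measurable_dkernel x N : measurable_fun setT (dkernel x N).
Proof.
apply: measurable_sum => t; apply: measurable_funM; first exact: measurable_cst.
apply: measurable_sum => d; apply: measurable_indic; exact: measurable_dcube.
Qed.

(** Equal to [2^(n-e)], the price of replacing [side (k + 1)] by [side k] in the kernel. *)
Definition Cker : R := side R 1 `^ (e - n%:R).

Lemma Cker_gt0 : 0 < Cker. Proof. by rewrite powR_gt0// side_gt0. Qed.

Lemma kernel_le_dkernel x y : exists N, Defs.edist x y `^ (e - n%:R) <= Cker * dkernel x N y.
Proof.
have en0 : e - n%:R != 0 by rewrite subr_eq0 lt_eqF.
have [<-|/eqP xy] := eqVneq x y.
  (* On the diagonal the kernel is 0 by the convention for powers of 0, so any [N] works. *)
  exists 0%N; rewrite edist_xx powR0// mulr_ge0 ?(ltW Cker_gt0)// lsum_ge0// => k.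
  exact: dkernel_term_ge0.
have [k [/near_codeP[d dy] kd]] := exists_level xy.
exists `|k|.+1%N.
apply: (@le_trans _ _ (Cker * side R k `^ (e - n%:R))).
  rewrite -powRM ?(ltW (side_gt0 _ _))// -sideD [1 + k]addrC.
  have -> : e - n%:R = - (n%:R - e) by rewrite opprB.
  rewrite !powRN lef_pV2 ?posrE ?powR_gt0 ?side_gt0 ?edist_gt0//.
  apply: ge0_ler_powR => //; rewrite ?nnegrE ?subr_ge0 ?(ltW en) ?(ltW (side_gt0 _ _))//.
  by rewrite ltW// edist_gt0.
rewrite ler_wpM2l ?(ltW Cker_gt0)//.
apply: le_trans (le_lsum (k := k) (dkernel_term_ge0 x y) _); last by lia.
rewrite ler_peMr ?powR_ge0// (bigD1 d)//= indicE mem_set// lerDl.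
by rewrite sumr_ge0.
Qed.

Lemma integral_dkernel x N :
  (\int[lebn R n]_y (`|f y| * dkernel x N y)%:E = (lsum (scale_term f e ^~ x) N)%:E)%E.
Proof.
have mf := measurable_loc_integrable locf.
have m1 k d : measurable_fun setT
    (fun y : Leb R n => (`|f y| * \1_(dcube R (shift (code k x) d)) y)%:E).
  apply/measurable_EFinP/measurable_funM; first exact: measurableT_comp.
  by apply: measurable_indic; exact: measurable_dcube.
have p1 k d y : (0 <= (`|f y| * \1_(dcube R (shift (code k x) d)) y)%:E)%E.
  by rewrite lee_fin mulr_ge0.
have i1 k d : (\int[lebn R n]_y (`|f y| * \1_(dcube R (shift (code k x) d)) y)%:E =
    (mass f (shift (code k x) d))%:E)%E.
  rewrite -massE// [RHS]integral_mkcond; apply: eq_integral => y _.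
  by rewrite patchE indicE; case: ifP => _; rewrite ?mulr1 ?mulr0.
under eq_integral => y _.
  rewrite /dkernel /lsum mulr_sumr -sumEFin.
  under eq_bigr => t _ do rewrite mulrCA mulr_sumr EFinM -sumEFin.
  over.
have s0 t : (0 <= (side R t `^ (e - n%:R))%:E)%E by rewrite lee_fin powR_ge0.
have mS k : measurable_fun setT
    (fun y : Leb R n => \sum_d (`|f y| * \1_(dcube R (shift (code k x) d)) y)%:E)%E.
  by apply: emeasurable_sum => d; exact: m1.
have pS k y : (0 <= \sum_d (`|f y| * \1_(dcube R (shift (code k x) d)) y)%:E)%E.
  by apply: sume_ge0 => d _; exact: p1.
rewrite (@ge0_integral_sum _ _ _ _ _ measurableT _ (fun t y => ((side R (t%:Z - N%:Z) `^ (e - n%:R))%:E *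
  \sum_d (`|f y| * \1_(dcube R (shift (code (t%:Z - N%:Z) x) d)) y)%:E)%E)).
- rewrite /lsum -sumEFin; apply: eq_bigr => t _.
  rewrite (ge0_integralZl _ measurableT (mS _) (fun y _ => pS _ y) (s0 _)).
  rewrite (ge0_integral_sum _ measurableT (m1 _) (fun d y _ => p1 _ d y)) EFinM.
  congr (_ * _)%E.
  by rewrite /near_mass -sumEFin; apply: eq_bigr => d _; exact: i1.
- by move=> t; apply: emeasurable_funM; [exact: measurable_cst|exact: mS].
- by move=> t y _; apply: mule_ge0; [exact: s0|exact: pS].
Qed.

(** The [N] of [kernel_le_dkernel] depends on [y], so the supremum is first taken inside the
    integral and then moved out by monotone convergence. *)
Lemma riesz_le_sup x : (riesz e (fun y => `|f y|)%R x <=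
  ereal_sup (range (fun N => (Cker * lsum (scale_term f e ^~ x) N)%:E)))%E.
Proof.
have mf := measurable_loc_integrable locf.
pose g N y : \bar R := (Cker * (`|f y| * dkernel x N y))%:E.
have dk0 N y : 0 <= dkernel x N y by apply: lsum_ge0 => k; exact: dkernel_term_ge0.
have mg0 N : measurable_fun setT (fun y => `|f y| * dkernel x N y).
  apply: measurable_funM; [exact: measurableT_comp|exact: measurable_dkernel].
apply: (@le_trans _ _ (\int[lebn R n]_y ereal_sup (range (g^~ y)))%E).
  apply: nonmeasurable_le_integral => y _.
    by rewrite lee_fin mulr_ge0 ?powR_ge0.
  have [N hN] := kernel_le_dkernel x y.
  apply: le_trans (ereal_sup_ubound _); last by exists N.
  by rewrite lee_fin mulrCA ler_wpM2l.
rewrite integral_range_sup.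
- apply: ereal_sup_le => _ [N _ <-]; exists N => //.
  rewrite /g; under [RHS]eq_integral => y _ do rewrite EFinM.
  rewrite [RHS]ge0_integralZl ?lee_fin ?(ltW Cker_gt0)//.
  + by rewrite integral_dkernel -EFinM.
  + exact/measurable_EFinP.
  + by move=> y _; rewrite lee_fin mulr_ge0.
- by move=> N; apply/measurable_EFinP/measurable_funM.
- move=> y N M NM; rewrite lee_fin !ler_wpM2l ?(ltW Cker_gt0)//.
  by apply: lsum_nd => // k; exact: dkernel_term_ge0.
- by move=> N y; rewrite lee_fin !mulr_ge0 ?(ltW Cker_gt0).
Qed.

End riesz_kernel.

Lemma esum_shift_level (R : realType) (n : nat) (k : int) d (a : dcode n -> \bar R) :
  (\esum_(c in [set c : dcode n | c.1 = k]) a (shift c d) <=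
   \esum_(c in [set c : dcode n | c.1 = k]) a c)%E.
Proof.
rewrite -(esum_image _ (fun c => shift c d) a) => [|c1 c2 _ _]; last exact: shift_inj.
by apply: esum_subset => _ [c ck <-].
Qed.

(** * Norm estimates *)

Section norm_estimates.
Context (R : realType) (n : nat).
Hypothesis n_gt0 : (0 < n)%N.
Hypothesis v0 : 0 < vol1 R n.
Context (p q : R).
Hypothesis p1 : 1 <= p.
Hypothesis pq : p < q.
Implicit Types (c : dcode n) (f : Leb R n -> R) (x y : Leb R n).

Let q0 : 0 < q. Proof. exact: lt_trans (lt_le_trans ltr01 p1) pq. Qed.
Let p0 : 0 < p. Proof. exact: lt_le_trans ltr01 p1. Qed.

Definition lam : R := n%:R * (p^-1 - q^-1).

Lemma lam_gt0 : 0 < lam.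
Proof. by rewrite mulr_gt0 ?ltr0n// subr_gt0 ltf_pV2 ?posrE. Qed.

Lemma lam_lt : lam < n%:R.
Proof.
rewrite /lam gtr_pMr ?ltr0n//; have : p^-1 <= 1 by rewrite invf_le1.
have : 0 < q^-1 by rewrite invr_gt0.
lra.
Qed.

(** The scaling identity that determines [lam]: [side^((lam-n)q)] times the volume of a cube is its
    volume to the power [kap], up to a constant. *)
Lemma lam_kap : (lam - n%:R) * q + n%:R = n%:R * kap p q.
Proof. by rewrite /lam /kap; field; rewrite !gt_eqF. Qed.

Lemma side_vol_beta f c :
  side R c.1 `^ ((lam - n%:R) * q) * vol R c * mass f c `^ q =
  vol1 R n `^ (1 - kap p q) * beta p q f c.
Proof.
have s0 := side_gt0 R c.1.
rewrite /beta mulrA; congr (_ * _).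
rewrite vol_side powRM ?exprn_ge0 ?(ltW s0) ?(ltW v0)//.
rewrite -(powR_mulrn _ (ltW s0)) -powRrM -lam_kap (powRD (x := side R c.1)); last by rewrite (gt_eqF s0) implybT.
have uE : vol1 R n = vol1 R n `^ (1 - kap p q) * vol1 R n `^ kap p q.
  by rewrite -powRD ?subrK ?powRr1 ?(ltW v0)// (gt_eqF v0) implybT.
by rewrite [in LHS]uE; ring.
Qed.

Lemma beta_shift f c d : side R c.1 `^ ((lam - n%:R) * q) * vol R c * mass f (shift c d) `^ q =
  vol1 R n `^ (1 - kap p q) * beta p q f (shift c d).
Proof. by rewrite -side_vol_beta !vol_side. Qed.

Definition Cscale : R := nshift R n `^ q * vol1 R n `^ (1 - kap p q).

Lemma Cscale_ge0 : 0 <= Cscale. Proof. by rewrite mulr_ge0 ?powR_ge0. Qed.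

(** [powR_sum_le] costs the q-th power of [nshift]; a further [nshift] appears because every cube is
    reached once by each shift. *)
Lemma integral_scale_term_powR f (k : int) : loc_integrable f ->
  (\int[lebn R n]_x (scale_term f lam k x `^ q)%:E <= (Cscale * nshift R n)%:E *
     \esum_(c in [set c : dcode n | (c.1 = k)%R]) (beta p q f c)%:E)%E.
Proof.
move=> locf; have b0 c : (0 <= (beta p q f c)%:E)%E by rewrite lee_fin beta_ge0.
rewrite (integral_levels k); last 2 first.
- apply/measurable_EFinP; apply: (measurableT_comp (measurable_powR q)).
  exact: measurable_scale_term.
- by move=> x; rewrite lee_fin powR_ge0.
apply: (@le_trans _ _ (\esum_(c in [set c : dcode n | (c.1 = k)%R])
    (Cscale%:E * \sum_d (beta p q f (shift c d))%:E))%E).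
  apply: le_esum => c ck; rewrite integral_dcube_level; last first.
    by move=> x y; rewrite ck => /scale_term_level ->.
  rewrite sumEFin -EFinM lee_fin /scale_term -{2}ck code_corner.
  rewrite powRM ?powR_ge0 ?near_mass_ge0// -powRrM -ck mulrAC.
  have h0 : 0 <= side R c.1 `^ ((lam - n%:R) * q) * vol R c.
    by rewrite mulr_ge0 ?powR_ge0// ltW// vol_gt0.
  have := ler_wpM2l h0 (@powR_sum_le R q _ (fun d => mass f (shift c d)) q0 _).
  move=> /(_ (fun d => mass_ge0 f (shift c d)))/le_trans; apply.
  rewrite mulrCA mulr_sumr (eq_bigr _ (fun d _ => beta_shift f c d)) -mulr_sumr mulrA.
  exact: lexx.
apply: (le_trans (esumZ_le _ (a := fun c => \sum_d (beta p q f (shift c d))%:E)%E Cscale_ge0 _)) => [c|].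
  by apply: sume_ge0.
set S := (X in (_ <= _ * X)%E).
have -> : ((Cscale * nshift R n)%:E * S = Cscale%:E * ((nshift R n)%:E * S))%E by rewrite muleA -EFinM.
apply: (@lee_wpmul2l R Cscale%:E); first by rewrite lee_fin Cscale_ge0.
rewrite {}/S.
rewrite esum_sum//.
apply: (@le_trans _ _ (\sum_(d : 'rV['I_3]_n)
    \esum_(c in [set c : dcode n | (c.1 = k)%R]) (beta p q f c)%:E)%E).
  apply: lee_sum => d _.
  exact: (esum_shift_level k d (fun c => (beta p q f c)%:E)).
rewrite (eq_bigr (fun=> 1%:E * \esum_(c in [set c : dcode n | (c.1 = k)%R]) (beta p q f c)%:E)%E); last first.
  by move=> d _; rewrite mul1e.
rewrite -ge0_sume_distrl; last by move=> d _; rewrite lee_fin.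
by rewrite sumEFin sumr_const.
Qed.

Lemma integral_lsum_powR : exists2 C : R, 0 < C & forall f N, loc_integrable f ->
  (\int[lebn R n]_x (lsum (scale_term f lam ^~ x) N `^ q)%:E <= C%:E * SR_norm p q f `^ q)%E.
Proof.
have rho01 : 0 < side R 1 `^ lam < 1.
  rewrite powR_gt0 ?side_gt0//= powR_lt1 ?lam_gt0//.
  by rewrite (ltW (side_gt0 _ _)) side1 invf_lt1 ?ltr1n.
have K0 : 0 <= nshift R n by exact: ler0n.
pose D := Cscale * nshift R n.
have D0 : 0 <= D by rewrite mulr_ge0// Cscale_ge0.
have Cg := Cgeo_gt0 n_gt0 p1 pq.
have [C C0 W] := @wolff _ (Leb R n) R (lebn R n) (dcode n) (nshift R n) (side R 1 `^ lam) q K0 rho01 q0.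
(* [D] is only known to be nonnegative, and [D + 1] makes the constant positive. *)
exists (C * (D + 1) * (2 * Cgeo n p q)).
  have D1 : 0 < D + 1 by apply: ltr_wpDl.
  by apply: mulr_gt0; apply: mulr_gt0.
move=> f N locf; pose pi (t : nat) := @code R n (t%:Z - N%:Z).
have fpi : filtration R pi.
  split => [i j x y ij|j w wj]; last exact: measurable_level wj.
  by apply: code_coarsen; lia.
have one_adapted : adapted pi 0 (fun=> 1 : R) by [].
have := W pi fpi _ (scale_term_decaying locf lam N) 0%N N.*2 (fun=> 1) (fun=> ler01) one_adapted.
under eq_integral => x _ do rewrite mul1r.
move=> /le_trans; apply.
rewrite -mulrA EFinM -muleA; apply: (@lee_wpmul2l R C%:E); first by rewrite lee_fin ltW.
under eq_bigr => t _ do under eq_integral => x _ do rewrite mul1r.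
have b0 c : (0 <= (beta p q f c)%:E)%E by rewrite lee_fin beta_ge0.
apply: (@le_trans _ _ (\sum_(0 <= t < N.*2) D%:E *
    \esum_(c in [set c : dcode n | (c.1 = t%:Z - N%:Z)%R]) (beta p q f c)%:E)%E).
  by apply: lee_sum => t _; exact: integral_scale_term_powR.
rewrite -ge0_sume_distrr; last by move=> t _; exact: esum_ge0.
apply: (@le_trans _ _ (D%:E * ((2 * Cgeo n p q)%:E * SR_norm p q f `^ q))%E).
  apply: (@lee_wpmul2l R D%:E); first by rewrite lee_fin.
  apply: le_trans (lsum_esum (b := beta p q f) N (beta_ge0 p q f)) _.
  exact: esum_beta_levels.
have -> : (((D + 1) * (2 * Cgeo n p q))%:E * SR_norm p q f `^ q =
    (D + 1)%:E * ((2 * Cgeo n p q)%:E * SR_norm p q f `^ q))%E by rewrite muleA -EFinM.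
apply: lee_wpmul2r; last by rewrite lee_fin lerDl.
by rewrite mule_ge0 ?poweR_ge0// lee_fin mulr_ge0// ltW.
Qed.

Definition riesz_abs f x : \bar R := riesz lam (fun y => `|f y|) x.

Lemma riesz_abs_ge0 f x : (0 <= riesz_abs f x)%E.
Proof. by apply: integral_ge0 => y _; rewrite lee_fin mulr_ge0 ?powR_ge0. Qed.

(** [z] is a measurable stand-in for the q-th power of the potential of [|f|], so that a finite
    integral yields finiteness almost everywhere. *)
Lemma riesz_majorant : exists2 C : R, 0 < C & forall f, loc_integrable f ->
  exists z : Leb R n -> \bar R, [/\ measurable_fun setT z,
    (forall x, riesz_abs f x `^ q <= z x)%E &
    (\int[lebn R n]_x z x <= C%:E * SR_norm p q f `^ q)%E].
Proof.
have [C C0 hC] := integral_lsum_powR.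
have K0 : 0 < Cker n lam by exact: Cker_gt0.
exists (Cker n lam `^ q * C); first by rewrite mulr_gt0// powR_gt0.
move=> f locf.
have G0 x N : 0 <= lsum (scale_term f lam ^~ x) N by apply: lsum_ge0 => k; exact: scale_term_ge0.
have mG N : measurable_fun setT (fun x => lsum (scale_term f lam ^~ x) N `^ q).
  apply: (measurableT_comp (measurable_powR q)).
  by apply: measurable_sum => t; exact: measurable_scale_term.
pose g N x : \bar R := ((Cker n lam) `^ q * lsum (scale_term f lam ^~ x) N `^ q)%:E.
have mg N : measurable_fun setT (g N).
  by apply/measurable_EFinP/measurable_funM => //; exact: mG.
have ndg x : {homo g^~ x : N M / (N <= M)%N >-> (N <= M)%E}.
  move=> N M NM; rewrite lee_fin; apply: ler_wpM2l; first exact: powR_ge0.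
  apply: ge0_ler_powR; rewrite ?nnegrE ?G0 ?(ltW q0)//.
  by apply: lsum_nd => // k; exact: scale_term_ge0.
exists (fun x => ereal_sup (range (g^~ x))); split; first exact: measurable_range_sup.
  move=> x; set z := ereal_sup _.
  have z0 : (0 <= z)%E.
    by apply: le_trans (ereal_sup_ubound _); last (by exists 0%N); rewrite lee_fin mulr_ge0 ?powR_ge0.
  have : (riesz_abs f x <= z `^ q^-1)%E.
    apply: le_trans (riesz_le_sup n_gt0 locf lam_lt x) _.
    apply: ge_ereal_sup => _ [N _ <-].
    have -> : (Cker n lam * lsum (scale_term f lam ^~ x) N)%:E = (g N x `^ q^-1)%E.
      rewrite /g -powRM ?(ltW K0)// poweR_EFin -powRrM mulfV ?gt_eqF// powRr1//.
      by rewrite mulr_ge0// ltW.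
    have gz : (g N x <= z)%E by apply: ereal_sup_ubound; exists N.
    have g0 : (0 <= g N x)%E by rewrite lee_fin mulr_ge0 ?powR_ge0.
    by apply: gt0_ler_poweR => //; rewrite ?invr_ge0 ?(ltW q0)// in_itv/= leey ?andbT ?g0.
  move=> h; have -> : z = ((z `^ q^-1) `^ q)%E by rewrite -poweRrM mulVf ?gt_eqF// poweRe1.
  by apply: gt0_ler_poweR => //; rewrite ?(ltW q0)// in_itv/= leey ?andbT ?poweR_ge0 ?riesz_abs_ge0.
rewrite integral_range_sup => [||x|N x]; [|exact: mg|exact: ndg|]; last first.
  by rewrite lee_fin mulr_ge0 ?powR_ge0.
apply: ge_ereal_sup => _ [N _ <-].
rewrite /g; under eq_integral => x _ do rewrite EFinM.
rewrite (ge0_integralZl _ measurableT); [|exact/measurable_EFinP/mG| |by rewrite lee_fin powR_ge0]; last first.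
  by move=> x _; rewrite lee_fin powR_ge0.
rewrite EFinM -muleA; apply: (@lee_wpmul2l R (Cker n lam `^ q)%:E); last exact: hC.
by rewrite lee_fin powR_ge0.
Qed.

Lemma riesz_le_abs f x : loc_integrable f -> (`|riesz lam f x| <= riesz_abs f x)%E.
Proof.
move=> locf; have mf := measurable_loc_integrable locf.
apply: le_trans (le_abse_integral _ measurableT _) _; first exact: measurable_riesz_integrand.
apply: nonmeasurable_le_integral => y _; first exact: abse_ge0.
by rewrite /riesz_integrand /= normrM [`|_ `^ _|]ger0_norm ?powR_ge0.
Qed.

Lemma H_norm_upper : exists2 C : R, 0 < C & forall f, loc_integrable f ->
  (H_norm lam q f <= C%:E * SR_norm p q f)%E.
Proof.
have [C C0 hC] := riesz_majorant.
exists (C `^ q^-1); first exact: powR_gt0.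
move=> f locf; have [z [mz fz zS]] := hC f locf.
have SR0 : (0 <= SR_norm p q f)%E.
  apply: le_trans (ereal_sup_ubound _); last first.
    exists set0 => //; split; first exact: countable0.
    by exists (fun=> set0).
  exact: poweR_ge0.
rewrite /H_norm unlock.
have -> : ((C `^ q^-1)%:E * SR_norm p q f = (C%:E * SR_norm p q f `^ q) `^ q^-1)%E.
  rewrite poweRM ?poweR_ge0 ?lee_fin ?(ltW C0)// -poweRrM mulfV ?gt_eqF// poweRe1//.
have I0 : (0 <= \int[lebn R n]_x `|riesz lam f x| `^ q)%E.
  by apply: integral_ge0 => x _; exact: poweR_ge0.
have IS : (\int[lebn R n]_x `|riesz lam f x| `^ q <= C%:E * SR_norm p q f `^ q)%E.
  apply: le_trans zS; apply: nonmeasurable_le_integral => x _; first exact: poweR_ge0.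
  apply: le_trans (fz x); apply: gt0_ler_poweR; first exact: ltW.
  - by rewrite in_itv/= leey abse_ge0.
  - by rewrite in_itv/= leey riesz_abs_ge0.
  - exact: riesz_le_abs.
apply: gt0_ler_poweR => //; first by rewrite invr_ge0 ltW.
  by rewrite in_itv/= leey I0.
by rewrite in_itv/= leey (le_trans I0 IS).
Qed.

(** The majorant [z] is integrable, hence finite almost everywhere, and where it is finite so is the
    potential of [|f|]. *)
Lemma riesz_integrable f : loc_integrable f -> (SR_norm p q f < +oo)%E ->
  {ae lebn R n, forall x, (lebn R n).-integrable setT (riesz_integrand lam f x)}.
Proof.
move=> locf SRf; have [C C0 hC] := riesz_majorant.
have [z [mz fz zS]] := hC f locf.
have mf := measurable_loc_integrable locf.
have z0 x : (0 <= z x)%E by apply: le_trans (fz x); exact: poweR_ge0.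
have iz : (lebn R n).-integrable setT z.
  apply/integrableP; split => //.
  under eq_integral => x _ do rewrite gee0_abs//.
  apply: le_lt_trans zS _; apply: lte_mul_pinfty; rewrite ?lee_fin ?(ltW C0)//.
  exact: poweR_lty.
apply: filterS (integrable_ae measurableT iz) => x /(_ I) zx.
apply/integrableP; split; first exact: measurable_riesz_integrand.
apply: (@le_lt_trans _ _ (riesz_abs f x)).
  apply: nonmeasurable_le_integral => y _; first exact: abse_ge0.
  by rewrite /riesz_integrand /= normrM [`|_ `^ _|]ger0_norm ?powR_ge0.
apply: (@lty_poweRy _ _ q); first by rewrite gt_eqF.
by apply: le_lt_trans (fz x) _; rewrite -ge0_fin_numE.
Qed.


End norm_estimates.

(** * Lower bound of the potential by sparse sums *)

Section lower_bound.
Context (R : realType) (n : nat).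
Hypothesis n_gt0 : (0 < n)%N.
Hypothesis v0 : 0 < vol1 R n.
Implicit Types (c : dcode n) (f : Leb R n -> R) (x y : Leb R n).

(* On the diagonal the kernel 0 `^ (lam - n) is 0 instead of +oo, so it is bounded
   below by its value at the diameter of a cube only off the point x. *)
Lemma ae_neq x : {ae lebn R n, forall y : Leb R n, y <> x}.
Proof.
pose A := \bigcap_(k in [set: nat]) dcube R (code k%:Z x).
have mA : measurable A by apply: bigcap_measurable => // k _; exact: measurable_dcube.
exists A; split => // [|y /= /contrapT -> k _]; last exact/dcubeP.
apply/eqP; rewrite eq_le measure_ge0 andbT.
(* [A] lies in cubes around [x] whose volumes shrink: [2^(-kn) <= 2^(-k) <= 1 / (k + 1)]. *)
have hA k : (lebn R n A <= (vol1 R n * (k.+1%:R)^-1)%:E)%E.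
  apply: (@le_trans _ _ (lebn R n (dcube R (code k%:Z x)))).
    apply: le_measure; rewrite ?inE//; first exact: measurable_dcube.
    by move=> y; exact.
  rewrite volE lee_fin vol_side mulrC ler_wpM2l ?(ltW v0)//.
  apply: (@le_trans _ _ (side R k%:Z)).
    rewrite -[leRHS]expr1 ler_wiXn2l ?(ltW (side_gt0 _ _))//.
    by rewrite /side -invr_expz invf_le1 ?exprz_gt0// exprn_ege1// ler1n.
  rewrite /side -invr_expz lef_pV2 ?posrE ?exprz_gt0//.
  by change (k.+1%:R <= 2%:R ^+ k :> R); rewrite -natrX ler_nat ltn_expl.
have fA : lebn R n A \is a fin_num.
  by rewrite ge0_fin_numE//; apply: le_lt_trans (hA 0%N) _; exact: ltry.
rewrite -(fineK fA) lee_fin leNgt; apply/negP => m0.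
set m := fine _ in m0.
pose k := Num.bound (vol1 R n / m).
have := hA k; rewrite -(fineK fA) lee_fin -/m ler_pdivlMr ?ltr0n// mulrC.
rewrite -ler_pdivlMr// leNgt => /negP; apply.
apply: lt_le_trans (archi_boundP _) _; first by rewrite divr_ge0 ?(ltW v0)// ltW.
by rewrite ler_nat leqnSn.
Qed.

Context (p q : R).
Hypothesis p1 : 1 <= p.
Hypothesis pq : p < q.

Let q0 : 0 < q. Proof. exact: lt_trans (lt_le_trans ltr01 p1) pq. Qed.

Local Notation lam := (lam n p q).

(** The diameter of [c] is at most [n] times its side and the exponent is negative, so on [c] the
    kernel off the diagonal is at least the first factor. *)
Definition lower_avg f c : R := (n%:R * side R c.1) `^ (lam - n%:R) * mass f c.

Lemma lower_avg_ge0 f c : 0 <= lower_avg f c.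
Proof. by rewrite mulr_ge0 ?powR_ge0 ?mass_ge0. Qed.

Lemma lower_avg_le f c x : loc_integrable f -> dcube R c x ->
  ((lower_avg f c)%:E <= riesz_abs p q f x)%E.
Proof.
move=> locf xc; have mf := measurable_loc_integrable locf.
have mk : measurable_fun setT (fun y : Leb R n => (`|f y| * Defs.edist x y `^ (lam - n%:R))%:E).
  apply/measurable_EFinP; apply: measurable_funM; first exact: measurableT_comp.
  exact: measurable_kernel.
have k0 y : (0 <= (`|f y| * Defs.edist x y `^ (lam - n%:R))%:E)%E.
  by rewrite lee_fin mulr_ge0 ?powR_ge0.
have mD := @measurable_dcube R n c.
apply: (@le_trans _ _ (\int[lebn R n]_(y in dcube R c) (`|f y| * Defs.edist x y `^ (lam - n%:R))%:E)%E);
  last first.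
  by apply: ge0_subset_integral => //; exact: measurableT.
pose a := (n%:R * side R c.1) `^ (lam - n%:R).
have a0 : (0 <= a%:E)%E by rewrite lee_fin powR_ge0.
have mfD : measurable_fun (dcube R c) (fun y => `|f y|%:E).
  exact/measurable_funTS/measurable_abs_loc.
apply: (@le_trans _ _ (\int[lebn R n]_(y in dcube R c) (a%:E * `|f y|%:E))%E).
  rewrite (ge0_integralZl _ mD)//.
  by rewrite massE// -EFinM.
apply: ae_ge0_le_integral.
- exact: mD.
- by move=> y _; rewrite mule_ge0// lee_fin.
- by apply: emeasurable_funM => //; exact: measurable_cst.
- by move=> y _; exact: k0.
- exact: measurable_funTS mk.
apply: filterS (ae_neq x) => y yx yc; rewrite -EFinM lee_fin mulrC; apply: ler_wpM2l => //.
have s0 := side_gt0 R c.1.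
have e0 : 0 < Defs.edist x y by apply: edist_gt0 => xy; exact: yx.
rewrite /a -opprB !powRN lef_pV2 ?posrE ?powR_gt0 ?mulr_gt0 ?ltr0n//.
apply: ge0_ler_powR; rewrite ?nnegrE ?subr_ge0 ?(ltW e0) ?(ltW (lam_lt n_gt0 p1 pq))//.
  by rewrite mulr_ge0// ltW.
by apply: edist_le; [exact: n_gt0|exact: ltW|exact: dcube_dist xc yc].
Qed.

Definition Clow : R := n%:R `^ ((lam - n%:R) * q) * vol1 R n `^ (1 - kap p q).

Lemma Clow_gt0 : 0 < Clow.
Proof. by rewrite mulr_gt0 ?powR_gt0// ltr0n. Qed.

Lemma lower_avg_powR f c : lower_avg f c `^ q * vol R c = Clow * beta p q f c.
Proof.
have s0 := ltW (side_gt0 R c.1).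
rewrite /lower_avg (powRM _ (powR_ge0 _ _) (mass_ge0 f c)) -powRrM powRM//.
rewrite mulrAC -mulrA -(mulrA _ (side R c.1 `^ _)) /Clow -(mulrA _ (vol1 R n `^ _)).
by rewrite -(side_vol_beta v0 p1 pq); ring.
Qed.

(** Each volume is at most twice that of [E c]. As these sets are disjoint, at most one term of the
    sum is nonzero at a point, and [lower_avg_le] bounds it there. The sign of [f] matters only when
    [riesz_abs] is later exchanged for [riesz]. *)
Lemma sum_sparse_le f (S X : set (dcode n)) : loc_integrable f -> sparse R S ->
  finite_set X -> X `<=` S ->
  (\sum_(c \in X) (beta p q f c)%:E <=
   (2 / Clow)%:E * \int[lebn R n]_x (riesz_abs p q f x `^ q))%E.
Proof.
move=> locf [_ [E [hE dE]]] finX XS.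
pose E' c := if c \in S then E c else set0.
have mE' c : measurable (E' c).
  by rewrite /E'; case: ifPn => [/[!inE] /hE[]//|_]; exact: measurable0.
have b0 c : 0 <= lower_avg f c `^ q by exact: powR_ge0.
have C0 := Clow_gt0.
have bE c : S c -> ((beta p q f c)%:E <= (2 / Clow)%:E *
    \int[lebn R n]_x ((lower_avg f c `^ q)%:E * (\1_(E' c) x)%:E))%E.
  move=> Sc; have [mE [EQ halfE]] := hE c Sc.
  rewrite ge0_integralZl//; last 2 first.
  - by apply/measurable_EFinP; exact: measurable_indic.
  - by rewrite lee_fin.
  rewrite integral_indic// setIT /E' mem_set//.
  have -> : (beta p q f c)%:E = ((2 / Clow)%:E * ((lower_avg f c `^ q)%:E * ((2^-1)%:E * (vol R c)%:E)))%E.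
    rewrite -!EFinM; congr EFin; rewrite [lower_avg f c `^ q * _]mulrCA lower_avg_powR.
    by field; rewrite gt_eqF.
  apply: lee_wpmul2l; first by rewrite lee_fin divr_ge0// ltW.
  apply: lee_wpmul2l; first by rewrite lee_fin.
  by rewrite -volE.
rewrite fsbig_finite//.
have /le_trans : (\sum_(c <- finmap.enum_fset (fset_set X)) (beta p q f c)%:E <=
  \sum_(c <- finmap.enum_fset (fset_set X)) (2 / Clow)%:E *
    \int[lebn R n]_x ((lower_avg f c `^ q)%:E * (\1_(E' c) x)%:E))%E.
  rewrite big_seq [leRHS]big_seq; apply: lee_sum => c.
  by rewrite in_fset_set// inE => /XS; exact: bE.
apply.
have t0 c x : (0 <= (lower_avg f c `^ q)%:E * (\1_(E' c) x)%:E)%E by rewrite mule_ge0// lee_fin.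
rewrite -ge0_sume_distrr; last by move=> c _; exact: integral_ge0.
apply: lee_wpmul2l; first by rewrite lee_fin divr_ge0// ltW.
have mt c : measurable_fun setT (fun x => (lower_avg f c `^ q)%:E * (\1_(E' c) x)%:E)%E.
  apply: emeasurable_funM; first exact: measurable_cst.
  by apply/measurable_EFinP; exact: measurable_indic.
rewrite -(ge0_integral_sum _ measurableT mt); last by move=> c x _; exact: t0.
apply: nonmeasurable_le_integral => x _; first exact: sume_ge0.
have [[c [cX Ex]]|nE] := pselect (exists c, X c /\ E' c x); last first.
  rewrite big_seq big1 ?poweR_ge0// => c; rewrite in_fset_set// inE => cX.
  by rewrite indicE memNset ?mule0// => Ex; apply: nE; exists c.
rewrite (bigD1_seq c) ?finmap.fset_uniq//=; last by rewrite in_fset_set// inE.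
rewrite big_seq_cond big1 ?adde0; last first.
  move=> c' /andP[]; rewrite in_fset_set// inE => c'X /eqP c'c.
  rewrite indicE memNset ?mule0// => Ex'.
  have : (E c' `&` E c) x.
    by move: Ex Ex'; rewrite /E' !mem_set//; exact: XS.
  by rewrite dE//; exact: XS.
rewrite indicE mem_set// mule1 -poweR_EFin.
have xc : dcube R c x.
  by move: Ex; rewrite /E' mem_set; [apply: (hE c _).2.1; exact: XS|exact: XS].
apply: gt0_ler_poweR; rewrite ?(ltW q0)// ?in_itv/= ?leey ?andbT ?lee_fin ?lower_avg_ge0//.
- exact: riesz_abs_ge0.
- exact: lower_avg_le.
Qed.

Lemma riesz_ge0_ae f x : loc_integrable f -> {ae lebn R n, forall y, 0 <= f y} ->
  riesz lam f x = riesz_abs p q f x.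
Proof.
move=> locf f0; have mf := measurable_loc_integrable locf.
apply: ae_eq_integral => //.
- exact: measurable_riesz_integrand.
- by apply: measurable_riesz_integrand; exact: measurableT_comp.
- by apply: filterS f0 => y fy _; rewrite /riesz_integrand /= ger0_norm.
Qed.

Lemma SR_norm_le : exists2 C : R, 0 < C & forall f, loc_integrable f ->
  {ae lebn R n, forall x, 0 <= f x} -> (SR_norm p q f <= C%:E * H_norm lam q f)%E.
Proof.
have C0 : 0 < 2 / Clow by rewrite divr_gt0// Clow_gt0.
exists ((2 / Clow) `^ q^-1); first exact: powR_gt0.
move=> f locf f0; apply: ge_ereal_sup => _ [S sS <-].
have -> : H_norm lam q f = ((\int[lebn R n]_x (riesz_abs p q f x `^ q)) `^ q^-1)%E.
  rewrite /H_norm unlock; congr (_ `^ _)%E; apply: eq_integral => x _.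
  by rewrite riesz_ge0_ae// gee0_abs// riesz_abs_ge0.
have I0 : (0 <= \int[lebn R n]_x (riesz_abs p q f x `^ q))%E.
  by apply: integral_ge0 => x _; exact: poweR_ge0.
rewrite -poweR_EFin -poweRM// ?lee_fin ?(ltW C0)//.
under eq_esum => c _ do rewrite (betaE p q c locf).
have s0 : (0 <= \esum_(c in S) (beta p q f c)%:E)%E.
  by apply: esum_ge0 => c _; rewrite lee_fin beta_ge0.
have sI : (\esum_(c in S) (beta p q f c)%:E <=
   (2 / Clow)%:E * \int[lebn R n]_x (riesz_abs p q f x `^ q))%E.
  by apply: ge_ereal_sup => _ [X [finX XS] <-]; exact: sum_sparse_le sS finX XS.
apply: gt0_ler_poweR => //; rewrite ?invr_ge0 ?(ltW q0)// in_itv/= leey ?s0//.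
by rewrite (le_trans s0 sI).
Qed.

End lower_bound.

(** * The alternative [vol1 = 0] *)

Section null_lebesgue.
Context (R : realType) (n : nat).
Hypothesis v0 : vol1 R n = 0.

Lemma null_lebn_dcube (c : dcode n) : lebn R n (dcube R c) = 0%E.
Proof. by rewrite volE vol_side v0 mulr0. Qed.

Lemma null_lebn : lebn R n setT = 0%E.
Proof.
have -> : [set: Leb R n] = \bigcup_(c in [set c : dcode n | c.1 = 0]) dcube R c.
  by apply/seteqP; split => // x _; exists (code 0 x) => //; exact/dcubeP.
rewrite measure_countable_bigcup.
- by apply: esum1 => c _; exact: null_lebn_dcube.
- by move=> c; exact: measurable_dcube.
- by apply: (@trivIset_level _ _ 0) => c.
Qed.

(** Comparison with the constant [+oo], whose integral over a null set is 0, covers nonmeasurable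
    [h] as well. *)
Lemma null_integral (D : set (Leb R n)) (h : Leb R n -> \bar R) : measurable D ->
  (forall x, 0 <= h x)%E -> (\int[lebn R n]_(x in D) h x = 0)%E.
Proof.
move=> mD h0; apply/eqP; rewrite eq_le integral_ge0// andbT.
apply: (@le_trans _ _ (\int[lebn R n]_(x in D) +oo)%E).
  by apply: nonmeasurable_le_integral => x _ //; exact: leey.
rewrite integral_cst// (_ : lebn R n D = 0%E) ?mule0//.
apply/eqP; rewrite eq_le measure_ge0 andbT -null_lebn.
by apply: le_measure; rewrite ?inE.
Qed.

Lemma null_SR_norm p q f : 0 < q -> (@SR_norm R n p q f = 0)%E.
Proof.
move=> q0; apply/eqP; rewrite eq_le; apply/andP; split; last first.
  apply: le_trans (ereal_sup_ubound _); last first.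
    exists set0 => //; split; first exact: countable0.
    by exists (fun=> set0).
  exact: poweR_ge0.
apply: ge_ereal_sup => _ [S _ <-].
rewrite esum1 ?poweR0r ?invr_neq0 ?gt_eqF// => c _.
rewrite null_integral ?mule0 ?poweR0r ?gt_eqF//; exact: measurable_dcube.
Qed.

Lemma null_H_norm lam q f : 0 < q -> (@H_norm R n lam q f = 0)%E.
Proof.
move=> q0; rewrite /H_norm unlock null_integral ?poweR0r ?invr_neq0 ?gt_eqF//.
by move=> x; exact: poweR_ge0.
Qed.

End null_lebesgue.

(** * Equivalence and embedding, both alternatives for [vol1] combined *)

Section equivalence.
Context (R : realType) (n : nat) (p q : R).
Hypothesis n_gt0 : (0 < n)%N.
Hypothesis p1 : 1 <= p.
Hypothesis pq : p < q.

Let q0 : 0 < q. Proof. exact: lt_trans (lt_le_trans ltr01 p1) pq. Qed.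

Lemma SR_H_equivalence : exists c C : R, 0 < c /\ 0 < C /\
  forall f : Leb R n -> R, loc_integrable f -> {ae lebn R n, forall x, 0 <= f x} ->
    (c%:E * SR_norm p q f <= H_norm (lam n p q) q f)%E /\
    (H_norm (lam n p q) q f <= C%:E * SR_norm p q f)%E.
Proof.
have := vol1_ge0 R n; rewrite le_eqVlt => /predU1P[/esym v0|v0].
  by exists 1, 1; split => //; split => // f _ _; rewrite null_SR_norm// null_H_norm// mule0.
have [C C0 hC] := SR_norm_le n_gt0 v0 p1 pq.
have [C' C'0 hC'] := H_norm_upper n_gt0 v0 p1 pq.
exists C^-1, C'; split; first by rewrite invr_gt0.
split => // f locf f0; split; last exact: hC'.
by rewrite lee_pdivrMl//; exact: hC.
Qed.

Lemma SR_H_embedding : exists C : R, 0 < C /\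
  forall f : Leb R n -> R, loc_integrable f -> (SR_norm p q f < +oo)%E ->
    {ae lebn R n, forall x, (lebn R n).-integrable setT (riesz_integrand (lam n p q) f x)} /\
    (H_norm (lam n p q) q f <= C%:E * SR_norm p q f)%E.
Proof.
have := vol1_ge0 R n; rewrite le_eqVlt => /predU1P[/esym v0|v0].
  exists 1; split => // f locf _; rewrite null_SR_norm// null_H_norm// mule0; split => //.
  apply: aeW => x; apply/integrableP; split.
    by apply: measurable_riesz_integrand; exact: measurable_loc_integrable.
  by rewrite null_integral// ?ltry// => y; exact: abse_ge0.
have [C C0 hC] := H_norm_upper n_gt0 v0 p1 pq.
exists C; split => // f locf SRf; split; last exact: hC.
exact: (riesz_integrable n_gt0 v0 p1 pq).
Qed.

End equivalence.

Theorem theorem1p6 (R : realType) (n : nat) (hn : (1 <= n)%N) :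
  (forall p q : R, 1 <= p -> p < q ->
    (* equivalence of norms for nonnegative f, lambda = n (1/p - 1/q) *)
    (exists c C : R, 0 < c /\ 0 < C /\
      forall f : Leb R n -> R, loc_integrable f ->
        {ae lebn R n, forall x, 0 <= f x} ->
        (c%:E * SR_norm p q f <= H_norm (n%:R * (p^-1 - q^-1)) q f)%E /\
        (H_norm (n%:R * (p^-1 - q^-1)) q f <= C%:E * SR_norm p q f)%E) /\
    (* embedding SR_{p,q} into H_q^{-n(1/p-1/q)} *)
    (exists C : R, 0 < C /\
      forall f : Leb R n -> R, loc_integrable f ->
        (SR_norm p q f < +oo)%E ->
        {ae lebn R n, forall x, (lebn R n).-integrable setT
           (riesz_integrand (n%:R * (p^-1 - q^-1)) f x)} /\
        (H_norm (n%:R * (p^-1 - q^-1)) q f <= C%:E * SR_norm p q f)%E)) /\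
  (* the case n >= 2, p = 2n/(n+2), q = 2 : H^{-1} = H_2^{-1} *)
  ((2 <= n)%N ->
    (exists c C : R, 0 < c /\ 0 < C /\
      forall f : Leb R n -> R, loc_integrable f ->
        {ae lebn R n, forall x, 0 <= f x} ->
        (c%:E * SR_norm (2 * n%:R / (n%:R + 2)) 2 f <= H_norm 1 2 f)%E /\
        (H_norm 1 2 f <= C%:E * SR_norm (2 * n%:R / (n%:R + 2)) 2 f)%E) /\
    (exists C : R, 0 < C /\
      forall f : Leb R n -> R, loc_integrable f ->
        (SR_norm (2 * n%:R / (n%:R + 2)) 2 f < +oo)%E ->
        {ae lebn R n, forall x, (lebn R n).-integrable setT
           (riesz_integrand 1 f x)} /\
        (H_norm 1 2 f <= C%:E * SR_norm (2 * n%:R / (n%:R + 2)) 2 f)%E)).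
Proof.
split=> [p q p1 pq|n2].
  by split; [exact: SR_H_equivalence|exact: SR_H_embedding].
set p : R := 2 * n%:R / (n%:R + 2).
have n2R : 2 <= n%:R :> R by rewrite ler_nat.
have n20 : 0 < n%:R + 2 :> R by lra.
(* [p >= 1] amounts to [n + 2 <= 2 n], that is [n >= 2]. *)
have p1 : 1 <= p by rewrite ler_pdivlMr//; lra.
have p2 : p < 2 by rewrite ltr_pdivrMr//; lra.
have lam1 : lam n p 2 = 1 by rewrite /lam /p; field; rewrite !gt_eqF//; lra.
split.
  by have := SR_H_equivalence hn p1 p2; rewrite lam1.
by have := SR_H_embedding hn p1 p2; rewrite lam1.
Qed.
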